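(* Let $\mathbf M=(M,N)$ be a flag matroid of rank $(1,n-1)$ on $[n]$ such that the translated polytope $P_{\mathbf M}-(1,\dots,1)$ contains the origin. Then $P_{\mathbf M}$ is a Bruhat polytope if and only if the symbol sequence $\alpha(\mathbf M)$ has no isolated $*$.
   Context: $M$ has rank 1, $N$ rank $n-1$, every flat of $M$ is a flat of $N$; $P_{\mathbf M}=\operatorname{conv}\{e_i:\{i\}\text{ basis of }M\}+\operatorname{conv}\{e_B:B\text{ basis of }N\}$ with $e_B=\sum_{i\in B}e_i$. The symbol sequence $\alpha(\mathbf M)=(\alpha_1,\dots,\alpha_n)\in\{0,+,-,*\}^n$ has $\alpha_i=*$ if $\{i\}$ is a basis of $M$ and $[n]\setminus\{i\}$ is a basis of $N$; $\alpha_i=-$ if $\{i\}$ is a basis of $M$ but $[n]\setminus\{i\}$ is not a basis of $N$; $\alpha_i=+$ if $[n]\setminus\{i\}$ is a basis of $N$ but $\{i\}$ is not a basis of $M$; $\alpha_i=0$ otherwise. It has an isolated $*$ if some $\alpha_i=*$ while neither $\alpha_{i-1}$ nor $\alpha_{i+1}$ is $*$ (with $\alpha_0,\alpha_{n+1}$ regarded as not $*$). Bruhat polytopes of rank $(1,n-1)$: for $x\in\operatorname{Sym}_n$ let $\pi(x)\in\mathbb{R}^n$ have $k$-th coordinate $0$ if $x(k)=1$, $2$ if $x(k)=n$, and $1$ otherwise. A permutation $v$ is minimal if it is minimal in Bruhat order among all $x$ with $\pi(x)=\pi(v)$. For $u\le v$ in Bruhat order with $v$ minimal, the Bruhat polytope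 is $Q_{u,v}=\operatorname{conv}\{\pi(x):u\le x\le v\}$. (''Bruhat order'': $u\le v$ iff a reduced word for $v$ in adjacent transpositions has a subword that is a word for $u$.) *)

(* Defs.v *)
From HB Require Import structures.
From mathcomp Require Import all_boot all_order all_fingroup all_algebra.
From mathcomp Require Import reals.
Set Implicit Arguments. Unset Strict Implicit. Unset Printing Implicit Defensive.
Import Order.TTheory GRing.Theory Num.Theory.
Local Open Scope ring_scope.

(* Ground set [n] is encoded as 'I_n = {0,...,n-1}: element k+1 of [n] is k. *)

Definition is_matroid n (B : {set {set 'I_n}}) : Prop :=
  B != set0 /\
  forall B1 B2, B1 \in B -> B2 \in B -> forall x, x \in B1 :\: B2 ->
    exists2 y, y \in B2 :\: B1 & (B1 :\ x) :|: [set y] \in B.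

Definition has_rank n (B : {set {set 'I_n}}) (r : nat) : Prop :=
  forall b, b \in B -> #|b| = r.

Definition mrank n (B : {set {set 'I_n}}) (A : {set 'I_n}) : nat :=
  \max_(b in B) #|A :&: b|.

Definition is_flat n (B : {set {set 'I_n}}) (F : {set 'I_n}) : Prop :=
  forall x, x \notin F -> (mrank B F < mrank B (x |: F))%N.

Definition flag_matroid_1_nm1 n (BM BN : {set {set 'I_n}}) : Prop :=
  [/\ is_matroid BM, is_matroid BN, has_rank BM 1, has_rank BN n.-1
    & forall F, is_flat BM F -> is_flat BN F].

Definition in_conv (R : realType) n (I : finType) (P : I -> Prop)
    (f : I -> 'rV[R]_n) (x : 'rV[R]_n) : Prop :=
  exists lam : I -> R,
    [/\ forall i, 0 <= lam i, forall i, ~ P i -> lam i = 0,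
        \sum_i lam i = 1 & x = \sum_i lam i *: f i].

Definition unit_vec (R : realType) n (i : 'I_n) : 'rV[R]_n :=
  \row_j (j == i)%:R.
Definition ind_vec (R : realType) n (S : {set 'I_n}) : 'rV[R]_n :=
  \row_j (j \in S)%:R.

Definition flag_polytope (R : realType) n (BM BN : {set {set 'I_n}})
    (x : 'rV[R]_n) : Prop :=
  exists a b,
    [/\ in_conv (fun i : 'I_n => [set i] \in BM) (@unit_vec R n) a,
        in_conv (fun S : {set 'I_n} => S \in BN) (@ind_vec R n) b
      & x = a + b].

Inductive symbol := Szero | Splus | Sminus | Sstar.

Definition alpha n (BM BN : {set {set 'I_n}}) (i : 'I_n) : symbol :=
  match [set i] \in BM, [set~ i] \in BN with
  | true, true => Sstar
  | true, false => Sminus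
  | false, true => Splus
  | false, false => Szero
  end.

Definition has_isolated_star n (BM BN : {set {set 'I_n}}) : Prop :=
  exists i : 'I_n, alpha BM BN i = Sstar /\
    forall j : 'I_n, ((val j).+1 = val i \/ val j = (val i).+1) ->
      alpha BM BN j <> Sstar.

(* adjacent transposition s_i = (i, i+1), used only when i.+1 < n *)
Definition adj_tr n (i : 'I_n) : {perm 'I_n} := tperm i (ordS i).

Definition adj_word n (w : seq 'I_n) : bool := all (fun i : 'I_n => (i.+1 < n)%N) w.

Definition word_prod n (w : seq 'I_n) : {perm 'I_n} :=
  foldr (fun i p => (adj_tr i * p)%g) 1%g w.

Definition reduced_word n (w : seq 'I_n) (v : {perm 'I_n}) : Prop :=
  [/\ adj_word w, word_prod w = v &
      forall w', adj_word w' -> word_prod w' = v -> (size w <= size w')%N].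

Definition bruhat_le n (u v : {perm 'I_n}) : Prop :=
  exists w, reduced_word w v /\ exists2 w', subseq w' w & word_prod w' = u.

Definition piv (R : realType) n (x : {perm 'I_n}) : 'rV[R]_n :=
  \row_k (if val (x k) == 0%N then 0
          else if val (x k) == n.-1 then 2 else 1).

Definition minimal_perm (R : realType) n (v : {perm 'I_n}) : Prop :=
  forall x, piv R x = piv R v -> bruhat_le x v -> x = v.

Definition bruhat_polytope (R : realType) n (u v : {perm 'I_n})
    (x : 'rV[R]_n) : Prop :=
  in_conv (fun y => bruhat_le u y /\ bruhat_le y v) (@piv R n) x.

Definition is_bruhat_polytope (R : realType) n (S : 'rV[R]_n -> Prop) : Prop :=
  exists u v : {perm 'I_n}, [/\ bruhat_le u v, minimal_perm R v &
    forall x, S x <-> bruhat_polytope u v x].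

(* Main.v *)
Require Import Defs.
From HB Require Import structures.
From mathcomp Require Import all_boot all_order all_fingroup all_algebra.
From mathcomp Require Import reals.
From mathcomp Require Import boolp zify lra.
Import Order.TTheory GRing.Theory Num.Theory.

(* A point of the flag polytope, translated by -(1,...,1), is a convex combination of
   e_i - e_j with {i} a basis of M and [n] \ {j} a basis of N; these points and the
   translated points pi(x) are roots or zero, so P_M = Q_{u,v} is a statement about pairs:
   the pairs (position of n, position of 1) of the permutations x in [u,v] must be
   the pairs i <> j in A x B, where A and B are the supports of M and of the dual
   of N.  The flag condition together with the origin being in the polytope says
   that A and B share at least two elements, the stars.

   Bruhat order is handled through rank functions (the tableau criterion).  For a
   minimal v, the rank function depends only on the positions a of 1 and b of n, and
   the condition that some x in [u,v] has its 1 (or its n) at a given position k is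
   a set of inequalities between the ranks of u and v around k.  If c is an isolated
   star and there is another star, these inequalities at c - 1, c, c + 1 contradict
   each other.  Conversely, v is a product of two sweeps of adjacent transpositions,
   moving 1 from the left end to a = max B and then n from the right end to
   b = min A; u is a subword of this word which forbids exactly the positions outside
   A and B, and each pair in A x B is reached by an intermediate subword. *)

(** * Rank functions and Bruhat order *)

Ltac blia :=
  repeat match goal with |- context [nat_of_bool ?b] => destruct b eqn:?; cbn [nat_of_bool] end;
  lia.

Definition rk {n} (x : {perm 'I_n}) (k j : nat) : nat :=
  (\sum_(p < n | p < k) (x p < j))%N.

(** The rank-matrix form of Bruhat order: going up, small values come later and ranks drop.
    [bruhat_leP] identifies it with the subword definition. *)
Definition ble {n} (u v : {perm 'I_n}) : Prop :=
  forall k j, (rk v k j <= rk u k j)%N.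

Lemma rk0 {n} (x : {perm 'I_n}) j : rk x 0 j = 0%N.
Proof. by rewrite /rk big_pred0. Qed.

Lemma rkS {n} (x : {perm 'I_n}) (k : 'I_n) j :
  rk x k.+1 j = (rk x k j + (x k < j))%N.
Proof.
rewrite /rk (bigD1 k) //= addnC; congr (_ + _)%N.
by apply: eq_bigl => p; rewrite -val_eqE /=; lia.
Qed.

Lemma rk_oversize {n} (x : {perm 'I_n}) k j : (n <= k)%N -> rk x k j = rk x n j.
Proof.
by move=> nk; apply: eq_bigl => p; have := ltn_ord p; lia.
Qed.

Lemma rk_overS {n} (x : {perm 'I_n}) k j : (n <= k)%N -> rk x k.+1 j = rk x k j.
Proof. by move=> nk; rewrite rk_oversize 1?leqW // -(rk_oversize x k). Qed.

Lemma rk_inv {n} (x : {perm 'I_n}) k j : rk x^-1%g k j = rk x j k.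
Proof.
rewrite /rk big_mkcond [RHS]big_mkcond (reindex_inj (@perm_inj _ x)) /=.
by apply: eq_bigr => p _; rewrite permK; do 2 case: ltnP.
Qed.

Lemma rk_id {n} k j : (k <= n)%N -> (j <= n)%N -> rk (1 : {perm 'I_n})%g k j = minn k j.
Proof.
move=> + jn; elim: k => [|k IH] kn; first by rewrite rk0 min0n.
by rewrite (rkS _ (Ordinal kn)) perm1 /= IH; lia.
Qed.

Lemma rk_le {n} (x : {perm 'I_n}) k j : (rk x k j <= k)%N.
Proof.
elim: k => [|k IH]; first by rewrite rk0.
case: (ltnP k n) => kn; first by rewrite (rkS _ (Ordinal kn)) /=; lia.
by rewrite rk_overS //; lia.
Qed.

Lemma rk_le_r {n} (x : {perm 'I_n}) k j : (rk x k j <= j)%N.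
Proof. by rewrite -rk_inv rk_le. Qed.

Lemma rk_full {n} (x : {perm 'I_n}) k j : (n <= j)%N -> (k <= n)%N -> rk x k j = k.
Proof.
move=> nj; elim: k => [|k IH] kn; first by rewrite rk0.
rewrite (rkS _ (Ordinal kn)) /= IH; last exact: ltnW.
by have := ltn_ord (x (Ordinal kn)); lia.
Qed.

Lemma rk_mono {n} (x : {perm 'I_n}) k d j :
  (rk x k j <= rk x (k + d) j)%N /\ (rk x (k + d) j <= rk x k j + d)%N.
Proof.
elim: d => [|d [IH1 IH2]]; first by rewrite !addn0; split.
rewrite addnS; case: (ltnP (k + d) n) => kn.
  by rewrite (rkS _ (Ordinal kn)) /=; lia.
by rewrite rk_overS //; lia.
Qed.

Lemma rk_mono_r {n} (x : {perm 'I_n}) k j d :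
  (rk x k j <= rk x k (j + d))%N /\ (rk x k (j + d) <= rk x k j + d)%N.
Proof. by rewrite -!(rk_inv x); exact: rk_mono. Qed.

Lemma rk_inj {n} (x y : {perm 'I_n}) : rk x =2 rk y -> x = y.
Proof.
move=> E; apply/permP => k; apply/val_inj.
have F j : (x k < j) = (y k < j).
  by have := E k.+1 j; rewrite !rkS E => /addnI; case: (x k < j); case: (y k < j).
by move: (F (x k).+1) (F (y k).+1); rewrite !ltnSn /=; lia.
Qed.

Lemma ble_refl {n} (x : {perm 'I_n}) : ble x x.
Proof. by []. Qed.

Lemma ble_trans {n} (y x z : {perm 'I_n}) : ble x y -> ble y z -> ble x z.
Proof. by move=> xy yz k j; apply: leq_trans (xy k j). Qed.

Lemma ble_anti {n} (x y : {perm 'I_n}) : ble x y -> ble y x -> x = y.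
Proof. by move=> xy yx; apply: rk_inj => k j; apply/eqP; rewrite eqn_leq xy yx. Qed.

(** All other entries are the same for every permutation: 0 for [j = 0], equal to [k] for [j] above
    [n], and constant in [k] from [n.+1] on. *)
Lemma bleP {n} (u v : {perm 'I_n.+1}) :
  (forall k j, (k <= n.+1)%N -> (0 < j <= n)%N -> (rk v k j <= rk u k j)%N) ->
  ble u v.
Proof.
move=> H k j; wlog kn : k / (k <= n.+1)%N.
  move=> W; case: (leqP k n.+1) => kn; first exact: W.
  by rewrite !(rk_oversize _ k) ?(ltnW kn) //; apply: W.
case: (posnP j) => [->|j0]; first by rewrite -!(rk_inv _ 0) !rk0.
case: (leqP j n) => jn; first by apply: H => //; rewrite j0.
by rewrite !rk_full.
Qed.

(** A prefix of length [m] notices the exchange only if it contains [p] but not [q], that is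
    [p < m <= q]. The corrections stand on both sides to avoid truncated subtraction. *)
Lemma rk_tperm {n} (x : {perm 'I_n}) (p q : 'I_n) m j : (p <= q)%N ->
  (rk (tperm p q * x)%g m j + ((p < m <= q)%N && (x p < j)) =
   rk x m j + ((p < m <= q)%N && (x q < j)))%N.
Proof.
move=> pq; elim: m => [|m IH]; first by rewrite !rk0.
case: (ltnP m n) => mn; last first.
  rewrite !rk_overS //.
  by have := ltn_ord q; lia.
rewrite !(rkS _ (Ordinal mn)) permM /=; set o := Ordinal mn.
have [E|np] := eqVneq o p.
  have Em : m = p by rewrite -E.
  rewrite E tpermL Em; rewrite Em in IH.
  have [E'|nq] := eqVneq p q; first by subst q; lia.
  by move: nq; rewrite -val_eqE /=; lia.
have [E|nq] := eqVneq o q.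
  have Em : m = q by rewrite -E.
  rewrite E tpermR; move: IH; rewrite Em; move: np; rewrite E -val_eqE /=; lia.
rewrite tpermD 1?eq_sym //; move: np nq; rewrite -!val_eqE /=; lia.
Qed.

Lemma ordS_lt {n} (i : 'I_n) : (i.+1 < n)%N -> ordS i = i.+1 :> nat.
Proof. by move=> h; rewrite /= modn_small. Qed.

Lemma adj_neq {n} (i : 'I_n) : (i.+1 < n)%N -> i != ordS i.
Proof. by move=> h; rewrite -val_eqE /= modn_small //; lia. Qed.

Lemma rk_adj {n} (x : {perm 'I_n}) (i : 'I_n) m j : (i.+1 < n)%N ->
  rk (adj_tr i * x)%g m j =
  if m == i.+1 then (rk x i j + (x (ordS i) < j))%N else rk x m j.
Proof.
move=> h; have := @rk_tperm _ x i (ordS i) m j; rewrite ordS_lt // leqnSn => /(_ isT).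
rewrite -/(adj_tr i); case: (eqVneq m i.+1) => [->|mi] E; last first.
  have F : (i < m <= i.+1)%N = false by lia.
  by move: E; rewrite F !addn0.
by move: E; rewrite ltnSn /= (rkS x i) addnAC => /addIn.
Qed.

Lemma rkSS {n} (x : {perm 'I_n}) (i : 'I_n) j : (i.+1 < n)%N ->
  rk x i.+2 j = (rk x i.+1 j + (x (ordS i) < j))%N.
Proof. by move=> h; have := rkS x (ordS i) j; rewrite ordS_lt. Qed.

Lemma ble_adj_asc {n} (x : {perm 'I_n}) (i : 'I_n) : (i.+1 < n)%N ->
  (x i < x (ordS i))%N -> ble x (adj_tr i * x)%g.
Proof.
move=> h lt k j; rewrite rk_adj //; case: eqVneq => // ->.
by rewrite (rkS x i); lia.
Qed.

(** Only the ranks at [i.+1] change. If [v (ordS i) < j] then also [v i < j], and the inequality at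
    [i.+2] suffices; otherwise the one at [i] does. *)
Lemma ble_lift {n} (u v : {perm 'I_n}) (i : 'I_n) : (i.+1 < n)%N ->
  (v i < v (ordS i))%N -> ble u v -> ble (adj_tr i * u)%g (adj_tr i * v)%g.
Proof.
move=> h lt uv k j; rewrite !rk_adj //; case: eqVneq => // _.
by move: (uv i j) (uv i.+2 j) (rkSS u i j h) (rkSS v i j h) (rkS u i j) (rkS v i j); blia.
Qed.

(** The lifting property of Bruhat order. If [u i < j], the inequality at [i] suffices; otherwise
    neither value of [u] is below [j], and the one at [i.+2] does. *)
Lemma ble_unlift {n} (u v : {perm 'I_n}) (i : 'I_n) : (i.+1 < n)%N ->
  (v (ordS i) < v i)%N -> (u i < u (ordS i))%N -> ble u v ->
  ble u (adj_tr i * v)%g.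
Proof.
move=> h ltv ltu uv k j; rewrite !rk_adj //; case: eqVneq => [->|_]; last exact: uv.
by move: (uv i j) (uv i.+2 j) (rkSS u i j h) (rkSS v i j h) (rkS u i j) (rkS v i j); blia.
Qed.

(* The last letter of a word acts first. *)
Fixpoint upword {n} (w : seq 'I_n) : bool :=
  if w is i :: w' then
    [&& (i.+1 < n)%N, (word_prod w' i < word_prod w' (ordS i))%N & upword w']
  else true.

(** A letter kept by [w'] is handled by [ble_lift]; a letter omitted by [w'] only raises the
    right-hand side. *)
Lemma up_subword {n} (w w' : seq 'I_n) :
  upword w -> subseq w' w -> ble (word_prod w') (word_prod w).
Proof.
elim: w w' => [|i w IH] w' /=; first by move=> _ /eqP ->.
case/and3P=> h lt up; case: w' => [|i' w'].
  move=> _; apply: ble_trans (ble_adj_asc _ _ h lt); apply: IH => //; exact: sub0seq.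
case: eqVneq => [->|_] sub /=; first by apply: ble_lift => //; apply: IH.
exact: ble_trans (IH _ up sub) (ble_adj_asc _ _ h lt).
Qed.

(** * Inversions, reduced words and the subword criterion *)

Definition inv_set {n} (x : {perm 'I_n}) : {set 'I_n * 'I_n} :=
  [set pq : 'I_n * 'I_n | (pq.1 < pq.2)%N && (x pq.2 < x pq.1)%N].

Lemma adj_tr_val {n} (i p : 'I_n) : (i.+1 < n)%N ->
  adj_tr i p = (if p == i :> nat then i.+1 else if p == i.+1 :> nat then i : nat else p) :> nat.
Proof.
move=> h; rewrite /adj_tr; case: tpermP => [->|->|].
- by rewrite eqxx ordS_lt.
- by rewrite ordS_lt // eqxx; case: eqP => //; lia.
move/eqP; rewrite -val_eqE /= => /negbTE ->.
by move/eqP; rewrite -val_eqE /= modn_small // => /negbTE ->.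
Qed.

(** Applying [adj_tr i] to both positions matches the inversions of [x] with those of the product
    other than [(i, ordS i)], which is the new one. *)
Lemma inv_adj {n} (x : {perm 'I_n}) (i : 'I_n) : (i.+1 < n)%N ->
  (x i < x (ordS i))%N -> #|inv_set (adj_tr i * x)%g| = #|inv_set x|.+1.
Proof.
move=> h lt; pose f (pq : 'I_n * 'I_n) := (adj_tr i pq.1, adj_tr i pq.2).
have fK : involutive f by move=> [p q]; rewrite /f /= !tpermK.
rewrite (cardsD1 (i, ordS i)) inE /= modn_small // ltnSn !permM tpermL tpermR lt add1n.
congr _.+1; rewrite -(card_imset _ (inv_inj fK)); apply: eq_card => -[p q].
rewrite -{1}(fK (p, q)) mem_imset; last exact: inv_inj.
rewrite /f !inE /= !permM !tpermK xpair_eqE -!(inj_eq val_inj) /= modn_small //.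
rewrite !adj_tr_val //.
have [pi|pi] := eqVneq (p : nat) i; have [qi|qi] := eqVneq (q : nat) i.
- by lia.
- have -> : p = i by exact: val_inj.
  case: (eqVneq (q : nat) i.+1) => [qs|]; last by lia.
  have -> : q = ordS i by apply: val_inj; rewrite /= modn_small.
  by lia.
- have -> : q = i by exact: val_inj.
  case: (eqVneq (p : nat) i.+1) => [ps|]; last by lia.
  have -> : p = ordS i by apply: val_inj; rewrite /= modn_small.
  by rewrite /= modn_small //; lia.
by case: (eqVneq (p : nat) i.+1) => [ps|ps];
  case: (eqVneq (q : nat) i.+1) => [qs|qs] /=; lia.
Qed.

Lemma adj_trK {n} (i : 'I_n) (x : {perm 'I_n}) : (adj_tr i * (adj_tr i * x) = x)%g.
Proof. by rewrite mulgA tperm2 mul1g. Qed.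

Lemma adj_asc_or {n} (x : {perm 'I_n}) (i : 'I_n) : (i.+1 < n)%N ->
  ~~ (x i < x (ordS i))%N ->
  (x (ordS i) < x i)%N /\ ((adj_tr i * x)%g i < (adj_tr i * x)%g (ordS i))%N.
Proof.
move=> h nlt; have lt : (x (ordS i) < x i)%N.
  have := adj_neq i h; rewrite -(inj_eq (@perm_inj _ x)) -val_eqE /=; lia.
by rewrite !permM tpermL tpermR.
Qed.

Lemma inv_set1 {n} : inv_set (1 : {perm 'I_n})%g = set0.
Proof. by apply/setP=> -[p q]; rewrite !inE !perm1 /=; lia. Qed.

(** A letter changes the number of inversions by exactly one, up at an ascent and down at a descent,
    so equality holds only if every letter is an ascent. *)
Lemma inv_word {n} (w : seq 'I_n) : adj_word w ->
  (#|inv_set (word_prod w)| <= size w)%N /\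
  (upword w = (#|inv_set (word_prod w)| == size w)).
Proof.
elim: w => [|i w IH] /=; first by rewrite inv_set1 cards0.
case/andP=> h /IH [le eq]; rewrite h /= eq; set y := word_prod w in le *.
have [lt|/(adj_asc_or _ _ h) [gt lt']] := boolP (y i < y (ordS i))%N.
  by rewrite (inv_adj y i) // ltnS eqSS.
have := inv_adj _ _ h lt'; rewrite adj_trK => E; rewrite E in le.
split; first exact: leqW (ltnW le).
by apply/esym/negbTE; rewrite neq_ltn ltnS (ltnW le).
Qed.

Lemma adj_word_up {n} (w : seq 'I_n) : upword w -> adj_word w.
Proof. by elim: w => //= i w IH /and3P[-> _ /IH]. Qed.

Lemma perm_no_descent {n} (x : {perm 'I_n}) :
  (forall i : 'I_n, (i.+1 < n)%N -> (x i < x (ordS i))%N) -> x = 1%g.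
Proof.
move=> H; apply: ble_anti => k j; last first.
  case: (leqP k n) => kn; last first.
    rewrite !(rk_oversize _ k) ?(ltnW kn) //.
    case: (leqP j n) => jn; first by rewrite rk_id // leq_min rk_le rk_le_r.
    by rewrite !rk_full // ltnW.
  case: (leqP j n) => jn; first by rewrite rk_id // leq_min rk_le rk_le_r.
  by rewrite !rk_full // ltnW.
(* Downward induction on the position, [d] being the number of positions after [p]: the value at [p]
   is less than the next one, which is at most [p.+1]. *)
suff ge d (p : 'I_n) : (p + d.+1 = n -> x p <= p)%N.
  apply: leq_sum => p _; rewrite perm1; case pj: (p < j) => //.
  by rewrite (leq_ltn_trans (ge (n - p.+1) p _) pj) //; have := ltn_ord p; lia.
elim: d p => [|d IH] p E; first by have := ltn_ord (x p); lia.
have pn : (p.+1 < n)%N by lia.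
have := H p pn; have := IH (ordS p); rewrite ordS_lt //; lia.
Qed.

Lemma exists_upword {n} (v : {perm 'I_n}) : exists2 w, upword w & word_prod w = v.
Proof.
move: {-1}#|_| (erefl #|inv_set v|) => m; elim: m v => [|m IH] v E.
  exists [::] => //=; rewrite (perm_no_descent v) // => i h.
  apply/negPn/negP => /(adj_asc_or _ _ h) [_ /(inv_adj _ _ h)].
  by rewrite adj_trK E.
have [/existsP[i /andP[h d]]|] :=
  boolP [exists i : 'I_n, (i.+1 < n)%N && ~~ (v i < v (ordS i))%N].
  have [_ lt] := adj_asc_or _ _ h d; have := inv_adj _ _ h lt.
  rewrite adj_trK E => -[/esym E']; have [w up Ew] := IH _ E'.
  by exists (i :: w); rewrite /= ?h ?Ew ?lt ?adj_trK.
rewrite negb_exists => /forallP H; move: E; rewrite (perm_no_descent v).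
  by rewrite inv_set1 cards0.
by move=> i h; have := H i; rewrite h negbK.
Qed.

(** Both sides say that the length of [w] is the inversion number of [v]: it bounds all words for
    [v] from below, and [exists_upword] attains it. *)
Lemma reduced_wordE {n} (w : seq 'I_n) v :
  reduced_word w v <-> upword w /\ word_prod w = v.
Proof.
split=> [[aw Ev min]|[up Ev]].
  split=> //; have [w' up' Ew'] := exists_upword v.
  have := min _ (adj_word_up _ up') Ew'.
  have [_ E'] := inv_word _ (adj_word_up _ up'); have [le ->] := inv_word _ aw.
  by rewrite E' in up'; rewrite Ew' in up'; move: up' le; rewrite Ev; lia.
split=> //; first exact: adj_word_up.
move=> w' aw' Ew'; have [_ E] := inv_word _ (adj_word_up _ up).
by have [le _] := inv_word _ aw'; move: up le; rewrite E Ev Ew'; lia.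
Qed.

(** The lifting property decides on the first letter [i]: it is dropped if [u] ascends at [i], and
    used, with [u] replaced by [adj_tr i * u], if [u] descends there. *)
Lemma ble_subword {n} (w : seq 'I_n) (u : {perm 'I_n}) :
  upword w -> ble u (word_prod w) -> exists2 w', subseq w' w & word_prod w' = u.
Proof.
elim: w u => [|i w IH] u /=.
  move=> _ uv; exists [::] => //=; apply: ble_anti => //.
  have [w' up <-] := exists_upword u.
  by have := up_subword _ [::] up (sub0seq _).
case/and3P=> h lt up uv.
have d : ((adj_tr i * word_prod w)%g (ordS i) < (adj_tr i * word_prod w)%g i)%N.
  by rewrite !permM tpermL tpermR.
have [lu|/(adj_asc_or _ _ h) [_ lu]] := boolP (u i < u (ordS i))%N.
  have := ble_unlift _ _ _ h d lu uv; rewrite adj_trK => /(IH _ up) [w' sw <-].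
  by exists w' => //; apply: subseq_trans sw (subseq_cons _ _).
have := ble_adj_asc _ _ h lu; rewrite adj_trK => /ble_trans /(_ uv).
move/(ble_unlift _ _ _ h d lu); rewrite adj_trK => /(IH _ up) [w' sw E].
by exists (i :: w'); rewrite /= ?eqxx // E adj_trK.
Qed.

Lemma bruhat_leP {n} (u v : {perm 'I_n}) : bruhat_le u v <-> ble u v.
Proof.
split=> [[w [/reduced_wordE [up <-] [w' sw <-]]]|uv]; first exact: up_subword.
have [w up E] := exists_upword v.
exists w; split; first exact/reduced_wordE.
by apply: ble_subword => //; rewrite E.
Qed.

(** * Minimal permutations *)

(* The rank function of the permutation with 0 at position a, the maximal value
   at position b and the other values in increasing order. *)
Definition mrk (a b k j : nat) : nat :=
  minn (k - (b < k)) (j.-1 + (a < k)).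

Lemma rk_le_max {n} (x : {perm 'I_n.+1}) (b : 'I_n.+1) k j :
  x b = ord_max -> (j <= n)%N -> (rk x k j + (b < k) <= k)%N.
Proof.
move=> xb jn; elim: k => [|k IH]; first by rewrite rk0.
case: (ltnP k n.+1) => kn; last first.
  by rewrite rk_overS //; move: IH; have := ltn_ord b; lia.
rewrite (rkS _ (Ordinal kn)) /=.
have [E|] := eqVneq (Ordinal kn) b; last by rewrite -val_eqE /=; blia.
by move: IH; rewrite E xb -E /=; blia.
Qed.

Lemma rk_le_min {n} (x : {perm 'I_n.+1}) (a : 'I_n.+1) k j :
  x a = ord0 -> (0 < j)%N -> (rk x k j + (k <= a) <= j)%N.
Proof.
move=> xa j0; suff: (rk x k j + ((0 < j) && (k <= a)) <= j)%N by rewrite j0.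
rewrite -rk_inv; elim: j {j0} => [|j IH]; first by rewrite rk0.
case: (ltnP j n.+1) => jn; last first.
  by rewrite rk_overS //; move: IH; case: j jn => //; lia.
rewrite (rkS _ (Ordinal jn)) /=; case: j jn IH => [|j] jn IH; last by move: IH; blia.
have -> : Ordinal jn = ord0 by exact: val_inj.
by rewrite -xa permK; move: IH; blia.
Qed.

(** The maximum is never counted, and 0 is not yet counted while [k <= a]. Since large ranks mean
    small permutations, a permutation attaining [mrk] is the least one with these two positions. *)
Lemma rk_le_mrk {n} (x : {perm 'I_n.+1}) (a b : 'I_n.+1) k j :
  x a = ord0 -> x b = ord_max -> (0 < j <= n)%N -> (rk x k j <= mrk a b k j)%N.
Proof.
move=> xa xb /andP[j0 jn]; rewrite /mrk.
by move: (rk_le_max x b k j xb jn) (rk_le_min x a k j xa j0); blia.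
Qed.

Definition middle_sorted {n} (x : {perm 'I_n.+1}) : Prop :=
  forall p q : 'I_n.+1, (p < q)%N -> (0 < x p < n)%N -> (0 < x q < n)%N ->
  (x p < x q)%N.

Lemma rk_sorted {n} (x : {perm 'I_n.+1}) (a b : 'I_n.+1) k j :
  x a = ord0 -> x b = ord_max -> middle_sorted x ->
  (0 < j <= n)%N -> (k <= n.+1)%N -> rk x k j = mrk a b k j.
Proof.
move=> xa xb sx jb kn; apply/eqP; rewrite eqn_leq rk_le_mrk //=.
case/andP: jb => j0 jn.
(* If a value that is at least [j] and not the maximum occurs before [k], sortedness puts all middle
   values below [j] before [k], and the second term of [mrk] is attained. Otherwise everything
   before [k] except [b] is counted, which attains the first. *)
have [/existsP[p /and3P[pk jp pb]]|] :=
  boolP [exists p : 'I_n.+1, [&& (p < k)%N, (j <= x p)%N & p != b]].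
  have xpn : (x p < n)%N.
    have := ltn_ord (x p); rewrite ltnS leq_eqVlt => /orP[/eqP E|//].
    case/negP: pb; apply/eqP/(@perm_inj _ x); rewrite xb; exact: val_inj.
  have H i : (i <= j -> i <= rk x^-1%g i k + ((0 < i) && (k <= a)))%N.
    elim: i => // i IH ij; have in1 : (i < n.+1)%N by lia.
    rewrite (rkS _ (Ordinal in1)) /=; have := IH (ltnW ij).
    case: i ij in1 {IH} => [|i] ij in1.
      have -> : Ordinal in1 = ord0 by exact: val_inj.
      by rewrite -xa permK; blia.
    set q := (x^-1)%g _; have xq : x q = i.+1 :> nat by rewrite permKV.
    suff -> : (q < k)%N by blia.
    rewrite ltnNge; apply/negP => kq.
    have := sx p q; rewrite xq; lia.
  by move: (H j (leqnn j)); rewrite rk_inv /mrk; blia.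
rewrite negb_exists => /forallP H.
have G i : (i <= k -> i <= rk x i j + (b < i))%N.
  elim: i => // i IH ik; have in1 : (i < n.+1)%N by lia.
  rewrite (rkS _ (Ordinal in1)) /=; have := IH (ltnW ik).
  have := H (Ordinal in1); rewrite /= ik /= negb_and negbK.
  case/orP => [|/eqP <-] /=; first by rewrite -ltnNge => ->; blia.
  by rewrite ltnSn; blia.
by move: (G k (leqnn k)); rewrite /mrk; blia.
Qed.

Lemma piv_coord (R : realType) {n} (x : {perm 'I_n.+1}) k :
  piv R x ord0 k = (if x k == ord0 then 0 else if x k == ord_max then 2%:R else 1)%R.
Proof. by rewrite mxE. Qed.

Lemma piv_pos (R : realType) {n} (x y : {perm 'I_n.+1}) : (0 < n)%N ->
  piv R x = piv R y -> forall k, (x k == ord0) = (y k == ord0) /\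
    (x k == ord_max) = (y k == ord_max).
Proof.
move=> n0 /rowP E k; have := E k; rewrite !piv_coord.
have om : (ord0 == ord_max :> 'I_n.+1) = false by rewrite -val_eqE /=; lia.
have R01 : (0 == 1 :> R)%R = false by rewrite eq_sym oner_eq0.
have R02 : (0 == 2%:R :> R)%R = false by rewrite eq_sym pnatr_eq0.
have R12 : (1 == 2%:R :> R)%R = false by rewrite (eqr_nat _ 1 2).
have [->|x0] := eqVneq (x k) ord0; have [->|y0] := eqVneq (y k) ord0; rewrite ?om.
- by [].
- by case: eqVneq => _ /eqP; rewrite ?R01 ?R02.
- by case: eqVneq => _ /eqP; rewrite eq_sym ?R01 ?R02.
case: (eqVneq (x k)) => _; case: (eqVneq (y k)) => _ // /eqP; rewrite ?R12 //.
by rewrite eq_sym R12.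
Qed.

(** Exchanging two middle values that are out of order preserves [piv] and goes down in Bruhat
    order. *)
Lemma minimal_sorted (R : realType) {n} (v : {perm 'I_n.+1}) :
  minimal_perm R v -> middle_sorted v.
Proof.
move=> vmin p q pq vp vq; rewrite ltnNge; apply/negP => vqp.
suff E : (tperm p q * v)%g = v.
  have := congr1 (fun z : {perm 'I_n.+1} => z p) E; rewrite permM tpermL.
  by move/perm_inj => E'; move: pq; rewrite E' ltnn.
apply: vmin.
  apply/rowP => k; rewrite !piv_coord permM.
  have mid r : (0 < v r < n)%N -> (v r == ord0) = false /\ (v r == ord_max) = false.
    by rewrite -!val_eqE /=; lia.
  have [p0 pN] := mid p vp; have [q0 qN] := mid q vq.
  by case: tpermP => [->|->|//]; rewrite p0 pN q0 qN.
apply/bruhat_leP => k j; have := rk_tperm v p q k j (ltnW pq); blia.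
Qed.

Lemma sorted_minimal (R : realType) {n} (v : {perm 'I_n.+1}) : (0 < n)%N ->
  middle_sorted v -> minimal_perm R v.
Proof.
move=> n0 sv x /(piv_pos _ _ _ n0) E /bruhat_leP xv; apply: ble_anti => //.
apply: bleP => k j kn jn.
have va : v ((v^-1)%g ord0) = ord0 by rewrite permKV.
have vb : v ((v^-1)%g ord_max) = ord_max by rewrite permKV.
rewrite (rk_sorted v _ _ _ _ va vb) //; apply: rk_le_mrk => //.
  by apply/eqP; have [-> _] := E ((v^-1)%g ord0); rewrite va.
by apply/eqP; have [_ ->] := E ((v^-1)%g ord_max); rewrite vb.
Qed.

(** * Positions of the extreme values in a Bruhat interval *)

Lemma mrk_lo a b k j : (k <= b)%N -> (k <= a)%N -> mrk a b k j = minn k j.-1.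
Proof. by rewrite /mrk ![(k <= _)%N]leqNgt => /negbTE -> /negbTE ->; rewrite subn0 addn0. Qed.

Lemma mrk_mid a b k j : (b < k <= a)%N -> mrk a b k j = minn k.-1 j.-1.
Proof. by rewrite /mrk [(k <= _)%N]leqNgt => /andP[-> /negbTE ->]; rewrite subn1 addn0. Qed.

Lemma mrk_hi a b k j : (b < k)%N -> (a < k)%N -> mrk a b k j = minn k.-1 j.-1.+1.
Proof. by rewrite /mrk => -> ->; rewrite subn1 addn1. Qed.

Lemma rk_mono_le {n} (x : {perm 'I_n}) k m j : (k <= m)%N ->
  (rk x k j <= rk x m j)%N /\ (rk x m j <= rk x k j + (m - k))%N.
Proof. by move=> km; have := rk_mono x k (m - k) j; rewrite subnKC. Qed.

(** The converse of [min_pos_rk]: the rank condition at [k] is sufficient as well. The witness comes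
    from [v] by one or two transpositions that bring 0 to [k]. *)
Lemma hit_min {n} (u v : {perm 'I_n.+1}) (a b k : 'I_n.+1) :
  v a = ord0 -> v b = ord_max -> middle_sorted v -> ble u v -> (b <= k < a)%N ->
  (forall j, (0 < j <= n)%N -> (mrk a b k j < rk u k.+1 j)%N) ->
  exists z, [/\ ble u z, ble z v & z k = ord0].
Proof.
move=> va vb sv uv /andP[bk ka] H.
have Hv m j := rk_sorted v a b m j va vb sv.
have [kb|kb] := eqVneq k b; last first.
  have {kb} bk : (b < k)%N by move: kb; rewrite -val_eqE /=; lia.
  have rz m j : (0 < j)%N ->
      rk (tperm k a * v)%g m j + ((k < m <= a) && (v k < j)) = rk v m j + (k < m <= a).
    by move=> j0; rewrite rk_tperm ?(ltnW ka) // va j0 andbT.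
  exists (tperm k a * v)%g; split; last by rewrite permM tpermL.
    apply: bleP => m j mn jn; have [j0 jn'] := andP jn; have := rz m j j0.
    case: (boolP (k < m <= a)) => /= km; last by move: (uv m j); lia.
    have := rkS v k j; rewrite !Hv //; last by lia.
    have [l1 l2] := rk_mono_le u k.+1 m j (proj1 (andP km)).
    by move: (H j jn) (uv m j); rewrite Hv // /mrk; blia.
  by apply: bleP => m j mn /andP[j0 jn]; have := rz m j j0; blia.
rewrite {k bk}kb in ka H *.
(* For [k = b], exchanging [b] and [a] would carry the maximum as far as [a]. The second exchange
   brings it back to [c], right after 0, which keeps [z] above [u]. *)
have an := ltn_ord a; pose c : 'I_n.+1 := inord b.+1.
have ck : c = b.+1 :> nat by rewrite inordK //; lia.
have ca : (c <= a)%N by lia.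
pose z1 := (tperm b a * v)%g; pose z := (tperm c a * z1)%g.
have rz1 m j : (0 < j <= n)%N -> rk z1 m j = rk v m j + (b < m <= a).
  move=> /andP[j0 jn]; have := rk_tperm v b a m j (ltnW ka); rewrite va vb j0 /=.
  by rewrite andbT [n < j]ltnNge jn andbF addn0 -/z1.
have rz m j : (0 < j <= n)%N ->
    rk z m j + ((b.+1 < m <= a) && (v c < j)) = rk v m j + (b < m <= a).
  move=> jn; rewrite -rz1 //; have := rk_tperm z1 c a m j ca.
  rewrite !permM !tpermR vb /= [n < j]ltnNge; have [_ ->] := andP jn.
  rewrite andbF addn0 -/z1 -/z ck => <-.
  case: (boolP (b.+1 < m <= a)) => //= cm.
  by rewrite tpermD // -val_eqE /= ?ck; lia.
exists z; split.
- apply: bleP => m j mn jn; have := rz m j jn.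
  case: (boolP (b < m <= a)) => /= km; last by move: (uv m j); lia.
  have [l1 l2] := rk_mono_le u b.+1 m j (proj1 (andP km)).
  have := H j jn; rewrite Hv // (mrk_lo _ _ b) ?(mrk_mid _ _ m) //; last exact: ltnW.
  have [mb|bm] := leqP m b.+1; first by rewrite /= addn0; clear -l1 km mb; lia.
  have := rkS v c j; rewrite ck !Hv // ?mrk_mid; [|by lia..].
  have uvm : (minn m.-1 j.-1 <= rk u m j)%N by rewrite -(mrk_mid a b) // -Hv.
  by move: (proj2 (andP km)) => -> /=; clear -jn l1 bm uvm; blia.
- by apply: bleP => m j mn jn; have := rz m j jn; blia.
have cb : c != b by rewrite -val_eqE /= ck; lia.
have ab : a != b by rewrite -val_eqE /=; lia.
by rewrite !permM (tpermD cb ab) tpermL.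
Qed.

(** The mirror image of [hit_min], and the converse of [max_pos_rk]. *)
Lemma hit_max {n} (u v : {perm 'I_n.+1}) (a b k : 'I_n.+1) :
  v a = ord0 -> v b = ord_max -> middle_sorted v -> ble u v -> (b < k <= a)%N ->
  (forall j, (0 < j <= n)%N -> (mrk a b k.+1 j <= rk u k j)%N) ->
  exists z, [/\ ble u z, ble z v & z k = ord_max].
Proof.
move=> va vb sv uv /andP[bk ka] H.
have Hv m j := rk_sorted v a b m j va vb sv.
have [kb|kb] := eqVneq k a; last first.
  have {kb} ka : (k < a)%N by move: kb; rewrite -val_eqE /=; lia.
  have rz m j : (j <= n)%N ->
      rk (tperm b k * v)%g m j = rk v m j + ((b < m <= k) && (v k < j)).
    move=> jn; rewrite -rk_tperm ?(ltnW bk) // vb /= [n < j]ltnNge jn.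
    by rewrite andbF addn0.
  exists (tperm b k * v)%g; split; last by rewrite permM tpermR.
    apply: bleP => m j mn jn; have [j0 jn'] := andP jn; have := rz m j jn'.
    case: (boolP (b < m <= k)) => /= km; last by move: (uv m j); lia.
    have := rkS v k j; rewrite !Hv //; last exact: ltnW.
    have [l1 l2] := rk_mono_le u m k j (proj2 (andP km)).
    by move: (H j jn) (uv m j); rewrite Hv // /mrk; blia.
  by apply: bleP => m j mn /andP[j0 jn]; have := rz m j jn; blia.
rewrite {k ka}kb in bk H *.
(* For [k = a] the displaced value is 0; it goes to [c], just before the maximum, and not as far
   back as [b]. *)
have an := ltn_ord a; pose c : 'I_n.+1 := inord a.-1.
have ck : c = a.-1 :> nat by rewrite inordK //; lia.
have ca : (b <= c)%N by lia.
pose z1 := (tperm b a * v)%g; pose z := (tperm b c * z1)%g.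
have rz1 m j : (0 < j <= n)%N -> rk z1 m j = rk v m j + (b < m <= a).
  move=> /andP[j0 jn]; have := rk_tperm v b a m j (ltnW bk); rewrite vb va j0 /=.
  by rewrite andbT [n < j]ltnNge jn andbF addn0 -/z1.
have rz m j : (0 < j <= n)%N ->
    rk z m j + (b < m <= a.-1) = rk v m j + (b < m <= a) + ((b < m <= a.-1) && (v c < j)).
  move=> jn; rewrite -rz1 //; have := rk_tperm z1 b c m j ca.
  rewrite !permM !tpermL va /=; have [-> _] := andP jn.
  rewrite andbT -/z1 -/z ck => ->.
  case: (boolP (b < m <= a.-1)) => //= cm.
  by rewrite tpermD // -val_eqE /= ?ck; lia.
exists z; split.
- apply: bleP => m j mn jn; have := rz m j jn.
  case: (boolP (b < m <= a)) => /= km; last by move: (uv m j); lia.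
  have [l1 l2] := rk_mono_le u m a j (proj2 (andP km)).
  have := H j jn; rewrite Hv // (mrk_hi _ _ a.+1) ?(mrk_mid _ _ m) //; last exact: ltnW.
  have [ma|am] := leqP a m.
    have -> : (b < m <= a.-1)%N = false by lia.
    have -> : m = a by lia.
    by rewrite /= !addn0; clear -jn bk; lia.
  have am' : (b < m <= a.-1)%N by lia.
  have := rkS v c j; rewrite ck prednK ?Hv // ?mrk_mid; [|by lia..].
  have uvm : (minn m.-1 j.-1 <= rk u m j)%N by rewrite -(mrk_mid a b) // -Hv.
  by rewrite am' /=; clear -jn l2 km am uvm; blia.
- by apply: bleP => m j mn jn; have := rz m j jn; blia.
have ba : b != a by rewrite -val_eqE /=; lia.
have ca' : c != a by rewrite -val_eqE /= ck; lia.
by rewrite !permM (tpermD ba ca') tpermR.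
Qed.

(** * Necessary rank conditions, and the neighbour of a star *)

Lemma rk_mono_r_le {n} (x : {perm 'I_n}) k i j : (i <= j)%N ->
  (rk x k i <= rk x k j)%N /\ (rk x k j <= rk x k i + (j - i))%N.
Proof. by move=> ij; have := rk_mono_r x k i (j - i); rewrite subnKC. Qed.

(** The ranks with [j = 1] record whether 0 has already occurred. *)
Lemma min_pos_le {n} (x v : {perm 'I_n.+1}) (a k : 'I_n.+1) :
  v a = ord0 -> ble x v -> x k = ord0 -> (k <= a)%N.
Proof.
move=> va xv xk; move: (rkS v a 1) (xv a.+1 1) (rk_le_min x k a.+1 1 xk isT).
by rewrite va /=; blia.
Qed.

(** The ranks with [j = n] miss only the maximum. *)
Lemma max_pos_ge {n} (x v : {perm 'I_n.+1}) (b k : 'I_n.+1) :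
  v b = ord_max -> ble x v -> x k = ord_max -> (b <= k)%N.
Proof.
move=> vb xv xk; move: (xv b n) (rk_le_max x k b n xk (leqnn n)).
suff -> : rk v b n = b by blia.
rewrite -[RHS](rk_full v _ n.+1) //; last exact: ltnW.
apply: eq_bigr => p pb; rewrite ltn_ord; congr (nat_of_bool _).
have := ltn_ord (v p); rewrite ltnS leq_eqVlt => /orP[/eqP E|->//].
have /perm_inj E' : v p = v b by rewrite vb; exact: val_inj.
by move: pb; rewrite E' ltnn.
Qed.

Lemma min_pos_rk {n} (u v x : {perm 'I_n.+1}) (c : 'I_n.+1) j :
  ble u x -> ble x v -> x c = ord0 -> (0 < j)%N -> (rk v c j < rk u c.+1 j)%N.
Proof.
by move=> ux xv xc j0; move: (ux c.+1 j) (xv c j) (rkS x c j); rewrite xc /=; blia.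
Qed.

Lemma max_pos_rk {n} (u v x : {perm 'I_n.+1}) (c : 'I_n.+1) j :
  ble u x -> ble x v -> x c = ord_max -> (j <= n)%N -> (rk v c.+1 j <= rk u c j)%N.
Proof.
by move=> ux xv xc jn; move: (ux c j) (xv c.+1 j) (rkS x c j); rewrite xc /=; blia.
Qed.

Lemma forall_or_fails {n} (P : nat -> bool) :
  (forall j, (0 < j <= n)%N -> P j) \/ (exists2 j, (0 < j <= n)%N & ~~ P j).
Proof.
have [/forallP H|] := boolP [forall j : 'I_n, P j.+1].
  by left=> -[//|j] jn; apply: (H (Ordinal _)).
by rewrite negb_forall => /existsP[j nP]; right; exists j.+1; rewrite ?ltn_ord.
Qed.

(** If no neighbour of [c] is hit by both extreme values, a criterion of [hit_min] or [hit_max]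
    fails on each side, and these failures contradict the inequalities valid at [c]. The second
    position [c'] gives [b < a]. *)
Lemma no_isolated {n} (u v : {perm 'I_n.+1}) (hits : 'I_n.+1 -> 'I_n.+1 -> Prop) :
  (0 < n)%N -> middle_sorted v -> ble u v ->
  (forall k y, hits k y <-> exists x, [/\ ble u x, ble x v & x k = y]) ->
  forall c c', c != c' -> hits c ord0 -> hits c ord_max ->
    hits c' ord0 -> hits c' ord_max ->
  exists k : 'I_n.+1, [/\ k.+1 = c \/ k = c.+1 :> nat, hits k ord0 & hits k ord_max].
Proof.
move=> n0 sv uv hitsP c c' cc' c0 cM c0' cM'.
pose a := (v^-1)%g ord0; pose b := (v^-1)%g ord_max.
have va : v a = ord0 by rewrite permKV.
have vb : v b = ord_max by rewrite permKV.
have Hv m j := rk_sorted v a b m j va vb sv.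
have lea k : hits k ord0 -> (k <= a)%N.
  by move=> /hitsP[x [_ xv xk]]; exact: min_pos_le va xv xk.
have geb k : hits k ord_max -> (b <= k)%N.
  by move=> /hitsP[x [_ xv xk]]; exact: max_pos_ge vb xv xk.
have hita : hits a ord0 by apply/hitsP; exists v; split=> //; exact: ble_refl.
have hitb : hits b ord_max by apply/hitsP; exists v; split=> //; exact: ble_refl.
have ba : (b < a)%N.
  move: (lea _ c0) (lea _ c0') (geb _ cM) (geb _ cM') cc'; rewrite -val_eqE /=; lia.
have [an cn] := (ltn_ord a, ltn_ord c).
have Bc j : (0 < j <= n)%N -> (mrk a b c j < rk u c.+1 j)%N.
  move=> jn; rewrite -Hv ?(ltnW cn) //; have [x [ux xv xc]] := proj1 (hitsP _ _) c0.
  by apply: (min_pos_rk _ _ _ _ _ ux xv xc); lia.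
have Ac j : (0 < j <= n)%N -> (mrk a b c.+1 j <= rk u c j)%N.
  move=> jn; rewrite -Hv //; have [x [ux xv xc]] := proj1 (hitsP _ _) cM.
  by apply: (max_pos_rk _ _ _ _ _ ux xv xc); lia.
(* At [k = a] the value 0, and at [k = b] the maximum, is provided by [v] itself, so the criteria
   are needed only away from these ends. *)
have nbr (k : 'I_n.+1) : (b <= k <= a)%N ->
  (hits k ord0 /\ hits k ord_max) \/
  (exists2 j, (0 < j <= n)%N & ((k < a) && (rk u k.+1 j <= mrk a b k j)) ||
                               ((b < k) && (rk u k j < mrk a b k.+1 j))).
  move=> bka.
  have [H0|[j jn H0]] := @forall_or_fails n (fun j => mrk a b k j < rk u k.+1 j);
  have [HM|[i im HM]] := @forall_or_fails n (fun j => mrk a b k.+1 j <= rk u k j).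
  - left; split.
      have [->//|ka] := eqVneq k a; apply/hitsP; apply: (hit_min u v a b) => //.
      by move: ka; rewrite -val_eqE /=; lia.
    have [->//|kb] := eqVneq k b; apply/hitsP; apply: (hit_max u v a b) => //.
    by move: kb; rewrite -val_eqE /=; lia.
  - have [E|kb] := eqVneq k b.
      left; split; last by rewrite E.
      apply/hitsP; apply: (hit_min u v a b) => //.
      by rewrite E leqnn.
    right; exists i => //; apply/orP; right.
    by move: HM kb; rewrite -val_eqE /=; lia.
  - have [E|ka] := eqVneq k a.
      left; split; first by rewrite E.
      apply/hitsP; apply: (hit_max u v a b) => //.
      by rewrite E leqnn andbT.
    right; exists j => //; apply/orP; left.
    by move: H0 ka; rewrite -val_eqE /=; lia.
  right; have [E|ka] := eqVneq k a; [exists i|exists j] => //; apply/orP; [right|left].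
    by move: HM; rewrite E; lia.
  by move: H0 ka; rewrite -val_eqE /=; lia.
have [lac gbc] := (lea _ c0, geb _ cM).
have up : (c < a)%N -> (exists k : 'I_n.+1, [/\ k.+1 = c \/ k = c.+1 :> nat,
    hits k ord0 & hits k ord_max]) \/
  (exists2 j, (0 < j <= n)%N & ((c.+1 < a) && (rk u c.+2 j <= mrk a b c.+1 j)) ||
                               (rk u c.+1 j < mrk a b c.+2 j)).
  move=> ca; have kn : (c.+1 < n.+1)%N by lia.
  case: (nbr (Ordinal kn)) => [/=|[h0 hM]|[j jn /= E]]; first by lia.
    by left; exists (Ordinal kn); split=> //; right.
  by right; exists j => //; move: E; case/orP=> [->//|/andP[_ ->]]; rewrite orbT.
have down : (b < c)%N -> (exists k : 'I_n.+1, [/\ k.+1 = c \/ k = c.+1 :> nat,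
    hits k ord0 & hits k ord_max]) \/
  (exists2 j, (0 < j <= n)%N & (rk u c j <= mrk a b c.-1 j) ||
                               ((b < c.-1) && (rk u c.-1 j < mrk a b c j))).
  move=> bc; have kn : (c.-1 < n.+1)%N by lia.
  case: (nbr (Ordinal kn)) => [/=|[h0 hM]|[j jn /= E]]; first by lia.
    by left; exists (Ordinal kn); split=> //; left; rewrite /=; lia.
  right; exists j => //; move: E; rewrite prednK; last by lia.
  by case/orP=> [/andP[_ ->]//|->]; rewrite orbT.
(* If [c] is one of the ends [b] and [a], the failure at its one neighbour between them is already
   contradictory. *)
have [cb|bc] := eqVneq (c : nat) b.
  case: (up _) => [|//|[j jn E]]; first by lia.
  exfalso; have [m1 _] := rk_mono_le u c.+1 c.+2 j (leqnSn _).
  by move: (Bc j jn) E; rewrite /mrk; blia.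
case: (down _) => [|//|[i im Ei]]; first by lia.
have [m1 m2] := rk_mono_le u c.-1 c i (leq_pred _).
have [ca|ac] := eqVneq (c : nat) a.
  by exfalso; move: (Ac i im) Ei; rewrite /mrk; blia.
case: (up _) => [|//|[j jn Ej]]; first by lia.
exfalso.
(* The failure at [c - 1] forces [i <= c], and then some position before [c] has a value of at least
   [c] under [u]. *)
have ci : (i <= c)%N by move: (Ac i im) Ei; rewrite /mrk; blia.
have [m3 m4] := rk_mono_r_le u c i c ci.
have fc : (rk u c c < c)%N by move: (Ac i im) Ei; rewrite /mrk; blia.
have c1n : (0 < c.+1 <= n)%N by lia.
have cn' : (0 < c <= n)%N by lia.
(* Together with [fc], the inequalities at [c] force [u] to map the positions up to [c] onto the
   values up to [c]. *)
have gc : rk u c.+1 c.+1 = c.+1.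
  move: (Bc c cn') (Ac _ c1n) (rkS u c c) (rkS u c c.+1) (rk_le u c.+1 c.+1).
  by rewrite /mrk; blia.
(* The failure at [c + 1] requires [j > c] and a rank of at most [c] at [(c.+1, j)], against
   [gc]. *)
have [m5 _] := rk_mono_le u c.+1 c.+2 j (leqnSn _).
have cj : (c.+1 <= j)%N by move: (Bc j jn) Ej; rewrite /mrk; blia.
have [m6 _] := rk_mono_r_le u c.+1 _ _ cj.
by move: Ej; rewrite /mrk; blia.
Qed.

(** * Words made of two sweeps *)

(** Adjacent transpositions modelled on [nat], so that a position can be followed through a word by
    arithmetic; [wperm_ev] is the link to permutations. *)
Definition sw (p l : nat) : nat := if p == l then l.+1 else if p == l.+1 then l else p.

Definition ev (w : seq nat) (p : nat) : nat := foldl sw p w.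
Arguments ev : simpl never.

Definition wperm n (w : seq nat) : {perm 'I_n.+1} := word_prod (map inord w).

Fixpoint upnat (w : seq nat) : bool :=
  if w is l :: w' then (ev w' l < ev w' l.+1) && upnat w' else true.

Lemma wperm_ev n w (p : 'I_n.+1) : all (ltn^~ n) w -> wperm n w p = ev w p :> nat.
Proof.
rewrite /wperm /ev; elim: w p => [|l w IH] p /=; first by rewrite perm1.
case/andP=> ln aw; rewrite permM IH // adj_tr_val ?inordK //; lia.
Qed.

Lemma upword_nat n w : all (ltn^~ n) w -> upnat w -> upword (map (@inord n) w).
Proof.
elim: w => //= l w IH /andP[ln aw] /andP[lt up].
have il : @inord n l = l :> nat by rewrite inordK //; lia.
rewrite il ltnS ln IH // andbT -!/(wperm n w) !wperm_ev // ordS_lt il //; lia.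
Qed.

Lemma ev_cat s t p : ev (s ++ t) p = ev t (ev s p).
Proof. exact: foldl_cat. Qed.

Lemma ev_l l w : ev (l :: w) l = ev w l.+1.
Proof. by rewrite /ev /= /sw eqxx. Qed.

Lemma ev_r l w : ev (l :: w) l.+1 = ev w l.
Proof. by rewrite /ev /= /sw eqxx (gtn_eqF (ltnSn l)). Qed.

Lemma ev_skip l w p : p != l -> p != l.+1 -> ev (l :: w) p = ev w p.
Proof. by move=> pl pl'; rewrite /ev /= /sw (negbTE pl) (negbTE pl'). Qed.

Lemma ev_fix w p : all (fun l => (l != p) && (l.+1 != p)) w -> ev w p = p.
Proof.
rewrite /ev; elim: w => //= l w IH /andP[/andP[lp lp'] aw].
by rewrite /sw ![p == _]eq_sym (negbTE lp) (negbTE lp') IH.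
Qed.

Lemma ev_commute l s p : all (ltn l.+1) s -> ev (l :: s) p = ev (rcons s l) p.
Proof.
rewrite /ev; elim: s p => //= k s IH p /andP[lk al]; rewrite -IH //=.
by congr foldl; rewrite /sw; repeat case: eqP => //=; lia.
Qed.

Lemma ev_commute_in l s1 s2 s3 p : all (ltn l.+1) s2 ->
  ev (s1 ++ s2 ++ l :: s3) p = ev (s1 ++ l :: s2 ++ s3) p.
Proof.
move=> al; rewrite -cat_rcons -cat_cons !ev_cat; congr ev.
by rewrite ev_commute.
Qed.

(** * Positions followed through ascending and descending words *)

Lemma ev_asc_lt (X : pred nat) l d p : p < l -> ev (filter X (iota l d)) p = p.
Proof.
move=> pl; apply: ev_fix; rewrite all_filter; apply/allP => k.
by rewrite mem_iota /=; case: (X k) => //=; lia.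
Qed.

(** Letters before [q] are too small to touch [q.+1]; the letter [q] moves it down to [q], which the
    later letters are too large to touch. *)
Lemma ev_asc_back (X : pred nat) l d q :
  l <= q < l + d -> X q -> ev (filter X (iota l d)) q.+1 = q.
Proof.
elim: d l => [|d IH] l; first by lia.
move=> qld Xq /=; have [E|ql] := eqVneq q l.
  by rewrite -E Xq ev_r ev_asc_lt.
have IH' : ev (filter X (iota l.+1 d)) q.+1 = q by apply: IH => //; lia.
by case: (X l) => //; rewrite ev_skip //; lia.
Qed.

(** Since the letter just below [q] is absent, the position is still at [q] when the letter [q] is
    read, and the run then carries it to the end. *)
Lemma ev_asc_run (X : pred nat) l d q : l <= q <= l + d ->
  (forall t, q <= t < l + d -> X t) -> (forall t, l <= t -> t.+1 = q -> ~~ X t) ->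
  ev (filter X (iota l d)) q = l + d.
Proof.
elim: d l q => [|d IH] l q qld Xq Xp; first by rewrite /ev /=; lia.
rewrite /= addnS -addSn; have [E|ql] := eqVneq q l.
  rewrite E Xq ?E ?ev_l; last by lia.
  by apply: IH => [|t tl|t tl]; [lia|apply: Xq; lia|lia].
have IH' : ev (filter X (iota l.+1 d)) q = l.+1 + d.
  by apply: IH => [|t tl|t tl]; [lia|apply: Xq; lia|apply: Xp; lia].
case Xl : (X l) => //; have [E|ql'] := eqVneq q l.+1.
  by have := Xp l (leqnn l) (esym E); rewrite Xl.
by rewrite ev_skip.
Qed.

Lemma rev_iotaS m : rev (iota 0 m.+1) = m :: rev (iota 0 m).
Proof. by rewrite -[m.+1]addn1 iotaD rev_cat. Qed.

Lemma ev_desc_gt (X : pred nat) m p : m < p -> ev (filter X (rev (iota 0 m))) p = p.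
Proof.
move=> pl; apply: ev_fix; rewrite all_filter; apply/allP => k.
by rewrite mem_rev mem_iota /=; case: (X k) => //=; lia.
Qed.

Lemma ev_desc_step (X : pred nat) m q :
  X q -> q < m -> ev (filter X (rev (iota 0 m))) q = q.+1.
Proof.
move=> Xq; elim: m => // m IH qm; rewrite rev_iotaS /=.
have [E|ql] := eqVneq q m.
  by rewrite -E Xq ev_l ev_desc_gt.
have IH' : ev (filter X (rev (iota 0 m))) q = q.+1 by apply: IH; lia.
by case: (X m) => //; rewrite ev_skip //; lia.
Qed.

Lemma ev_desc_run (X : pred nat) m q : q <= m -> (q < m -> ~~ X q) ->
  (forall t, t < q -> X t) -> ev (filter X (rev (iota 0 m))) q = 0.
Proof.
elim: m q => [|m IH] q qm nX Xt; first by rewrite /ev /=; lia.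
rewrite rev_iotaS /=; have [E|ql] := eqVneq q m.+1.
  rewrite E Xt ?E // ev_r.
  by apply: IH => // [|t tm]; [lia|apply: Xt; lia].
have IH' : ev (filter X (rev (iota 0 m))) q = 0.
  by apply: IH => // [|qm']; [lia|apply: nX; lia].
case Xm: (X m) => //; have [E|qm'] := eqVneq q m.
  by have := nX ltac:(lia); rewrite E Xm.
by rewrite ev_skip.
Qed.

Lemma ev_desc_le (X : pred nat) m p :
  (p < m -> ~~ X p) -> ev (filter X (rev (iota 0 m))) p <= p.
Proof.
elim: m p => [|m IH] p nX //; rewrite rev_iotaS /=.
case Xm: (X m); last by apply: IH => pm; apply: nX; lia.
have [E|pm] := eqVneq p m.
  by have pm := nX ltac:(lia); rewrite E Xm in pm.
have [->|pm'] := eqVneq p m.+1.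
  by rewrite ev_r; apply: (leq_trans (IH m _)); rewrite ?ltnn ?leqnSn.
by rewrite ev_skip //; apply: IH => pm''; apply: nX; lia.
Qed.

Lemma ev_desc_ge (X : pred nat) m p :
  (forall q, p = q.+1 -> q < m -> ~~ X q) -> p <= ev (filter X (rev (iota 0 m))) p.
Proof.
elim: m p => [|m IH] p nX //; rewrite rev_iotaS /=.
have IH' : p <= ev (filter X (rev (iota 0 m))) p.
  by apply: IH => q E qm; apply: nX => //; lia.
case Xm: (X m) => //.
have [->|pm] := eqVneq p m; first by rewrite ev_l ev_desc_gt.
have [E|pm'] := eqVneq p m.+1; last by rewrite ev_skip.
by have := nX m E (leqnn _); rewrite Xm.
Qed.

(* Two sweeps: going right with the letters of X1, which carries the value 0, then
   going left with the letters of X2, which carries the maximal value. *)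
Definition sweeps n (X1 X2 : pred nat) : seq nat :=
  filter X2 (iota 0 n) ++ filter X1 (rev (iota 0 n)).

Lemma all_sweeps n X1 X2 : all (ltn^~ n) (sweeps n X1 X2).
Proof.
rewrite all_cat !all_filter; apply/andP; split; apply/allP => k.
  by rewrite mem_iota /= => ->; rewrite implybT.
by rewrite mem_rev mem_iota /= => ->; rewrite implybT.
Qed.

(** The condition under which the word is reduced. If [X1] has [t] but not [t.+1], its sweep inverts
    [t] and [t.+1], and a letter [t] of [X2] would cancel this unless the letter [t.+1] of [X2]
    intervenes. *)
Definition sweepable n (X1 X2 : pred nat) : Prop :=
  (forall t, X1 t -> t.+1 < n) /\
  (forall t, X1 t -> X2 t -> ~~ X2 t.+1 -> X1 t.+1).

Lemma upnat_desc (X : pred nat) m : upnat (filter X (rev (iota 0 m))).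
Proof.
elim: m => // m IH; rewrite rev_iotaS /=; case: (X m) => //=.
by rewrite IH (ev_desc_gt X m m.+1) // ltnS ev_desc_le // ltnn.
Qed.

Lemma upnat_sweeps n X1 X2 : sweepable n X1 X2 -> upnat (sweeps n X1 X2).
Proof.
case=> X1n X12; pose w l d := filter X2 (iota l d) ++ filter X1 (rev (iota 0 n)).
(* The second claim strengthens the induction: when [X2] contains two consecutive letters, the
   larger one has already pushed its position beyond the image of the smaller. *)
suff H d l : l + d = n ->
    upnat (w l d) /\ (0 < d -> X2 l -> l < ev (w l d) l) by case: (H n 0).
elim: d l => [|d IH] l ldn; first by split=> //; exact: upnat_desc.
have [up gt] := IH l.+1 ltac:(lia); rewrite /w /=.
case X2l: (X2 l) => //=; rewrite -/(w l.+1 d).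
have e1 : ev (w l.+1 d) l = ev (filter X1 (rev (iota 0 n))) l.
  by rewrite /w ev_cat ev_asc_lt.
have le1 : ev (w l.+1 d) l <= l.+1.
  rewrite e1; case X1l: (X1 l); first by rewrite ev_desc_step //; lia.
  by apply: leqW; apply: ev_desc_le => _; rewrite X1l.
have e2 : ev (l :: w l.+1 d) l = ev (w l.+1 d) l.+1 by rewrite ev_l.
suff lt : ev (w l.+1 d) l < ev (w l.+1 d) l.+1 /\ l < ev (w l.+1 d) l.+1.
  by rewrite e2 up (proj1 lt) (proj2 lt).
have [X2l'|X2l'] := boolP ((0 < d) && X2 l.+1).
  by case/andP: X2l' => d0 /(gt d0); lia.
have e3 : ev (w l.+1 d) l.+1 = ev (filter X1 (rev (iota 0 n))) l.+1.
  rewrite /w ev_cat; case: (d) X2l' => //= d'.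
  by move/negbTE => ->; rewrite ev_asc_lt.
rewrite e1 e3; case X1l: (X1 l); last first.
  have : ev (filter X1 (rev (iota 0 n))) l <= l by apply: ev_desc_le; rewrite X1l.
  have : l.+1 <= ev (filter X1 (rev (iota 0 n))) l.+1.
    by apply: ev_desc_ge => q [<-]; rewrite X1l.
  by lia.
have ln := X1n l X1l; have d0 : 0 < d by lia.
rewrite d0 /= in X2l'; have X1l' := X12 l X1l X2l X2l'.
by rewrite !ev_desc_step //; lia.
Qed.

Lemma sweeps_le n X1 X2 w : sweepable n X1 X2 -> subseq w (sweeps n X1 X2) ->
  ble (wperm n w) (wperm n (sweeps n X1 X2)).
Proof.
move=> sX sub; apply: up_subword; last exact: map_subseq.
by apply: upword_nat; [exact: all_sweeps|exact: upnat_sweeps].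
Qed.

Lemma subseq_filter_sub (X Y : pred nat) s : {in s, forall p, X p -> Y p} ->
  subseq (filter X s) (filter Y s).
Proof.
move=> XY; rewrite subseq_filter filter_subseq andbT all_filter.
by apply/allP => p ps; apply/implyP; apply: XY.
Qed.

Lemma sweeps_sub n (X1 X2 Y1 Y2 : pred nat) :
  (forall p, p < n -> X1 p -> Y1 p) -> (forall p, p < n -> X2 p -> Y2 p) ->
  subseq (sweeps n X1 X2) (sweeps n Y1 Y2).
Proof.
move=> XY1 XY2; apply: cat_subseq; apply: subseq_filter_sub => p.
  by rewrite mem_iota => /= pn; apply: XY2.
by rewrite mem_rev mem_iota => /= pn; apply: XY1.
Qed.

Lemma iota_split l n : l < n -> iota 0 n = iota 0 l ++ l :: iota l.+1 (n - l.+1).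
Proof. by move=> ln; rewrite -[in LHS](subnKC ln) addSnnS iotaD. Qed.

(** Every letter between the two places of [l] exceeds [l.+1], hence commutes with [l]. *)
Lemma sweeps_transfer n (X1 X2 : pred nat) l : l < n ->
  X2 l -> ~~ X1 l -> ~~ X1 l.+1 -> ~~ X2 l.+1 ->
  wperm n (sweeps n (fun p => X1 p || (p == l)) (fun p => X2 p && (p != l))) =
  wperm n (sweeps n X1 X2).
Proof.
move=> ln X2l nX1l nX1 nX2; apply/permP => p; apply: val_inj => /=.
rewrite !wperm_ev ?all_sweeps // /sweeps (iota_split l n ln) rev_cat rev_cons.
rewrite -!cats1 !filter_cat /= X2l (negbTE nX1l) !eqxx orbT andbF /= cats0.
have F1 : {in iota 0 l, (fun p => X2 p && (p != l)) =1 X2}.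
  by move=> q; rewrite mem_iota /= => ql; rewrite (_ : q != l) ?andbT //; lia.
have F2 : {in iota l.+1 (n - l.+1), (fun p => X2 p && (p != l)) =1 X2}.
  by move=> q; rewrite mem_iota /= => ql; rewrite (_ : q != l) ?andbT //; lia.
have G1 : {in rev (iota 0 l), (fun p => X1 p || (p == l)) =1 X1}.
  by move=> q; rewrite mem_rev mem_iota /= => ql; rewrite (_ : (q == l) = false) ?orbF //; lia.
have G2 : {in rev (iota l.+1 (n - l.+1)), (fun p => X1 p || (p == l)) =1 X1}.
  by move=> q; rewrite mem_rev mem_iota /= => ql; rewrite (_ : (q == l) = false) ?orbF //; lia.
rewrite (eq_in_filter F1) (eq_in_filter F2) (eq_in_filter G1) (eq_in_filter G2).
rewrite -!catA /=; set S := filter X2 (iota l.+1 _).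
rewrite (catA S) [in RHS](catA S); apply: ev_commute_in.
rewrite all_cat !all_filter; apply/andP; split; apply/allP => q;
  rewrite ?mem_rev mem_iota => lq; apply/implyP => Xq /=.
  by case: (eqVneq q l.+1) Xq nX2 => [->->//|]; lia.
by case: (eqVneq q l.+1) Xq nX1 => [->->//|]; lia.
Qed.

(** * An interval with prescribed supports *)

Lemma ev_fix_desc (X : pred nat) m p : ~~ X p -> (forall q, q.+1 = p -> ~~ X q) ->
  ev (filter X (rev (iota 0 m))) p = p.
Proof.
move=> nX nX'; apply: ev_fix; rewrite all_filter; apply/allP => q _.
apply/implyP => Xq; apply/andP; split; apply/eqP => E.
  by move: nX; rewrite -E Xq.
by have := nX' q E; rewrite Xq.
Qed.

Lemma ev_fix_asc (X : pred nat) m p : ~~ X p -> (forall q, q.+1 = p -> ~~ X q) ->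
  ev (filter X (iota 0 m)) p = p.
Proof.
move=> nX nX'; apply: ev_fix; rewrite all_filter; apply/allP => q _.
apply/implyP => Xq; apply/andP; split; apply/eqP => E.
  by move: nX; rewrite -E Xq.
by have := nX' q E; rewrite Xq.
Qed.

Lemma rk_wperm_cons n k w j : k < n -> all (ltn^~ n) w ->
  rk (wperm n (k :: w)) k.+1 j = rk (wperm n w) k j + (ev w k.+1 < j).
Proof.
move=> kn aw; have ik : @inord n k = k :> nat by rewrite inordK //; lia.
have := rk_adj (wperm n w) (inord k) k.+1 j; rewrite ik eqxx ltnS => /(_ kn).
rewrite -[(adj_tr _ * _)%g]/(wperm n (k :: w)) => ->; congr (_ + nat_of_bool (_ < _)).
by rewrite wperm_ev // ordS_lt ik.
Qed.

Section Sufficiency.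

Variables (n : nat) (A B : pred nat) (a b : nat).
Hypotheses (Ab : A b) (Ba : B a) (an : a <= n) (ba : b < a).
Hypothesis Age : forall p, A p -> b <= p <= n.
Hypothesis Ble : forall p, B p -> p <= a.
Hypothesis noniso : forall p, A p -> B p ->
  (A p.+1 && B p.+1) \/ exists2 q, p = q.+1 & A q && B q.

(** The permutation [v] has its maximum at [b] and 0 at [a]. The letters of [V2] are read first and
    shift [a] to [a.-1], which explains the bound [p.+1 < a]. *)
Let V1 p := p.+1 < a.
Let V2 p := b <= p.
Let v := wperm n (sweeps n V1 V2).
(** A letter [p] of [U1] keeps 0 away from [p], or from [p.+1] when the shift by [V2] applies; a
    letter [p] of [U2] with [p.+1] outside [A] keeps the maximum away from [p.+1]. The last disjunct
    of [U2] supplies letters missing from [U1], so that each non-star from [b] up to before [a] has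
    its letter in some sweep ([nextU]). *)
Let U1 p := (p.+1 < a) && (if p < b then ~~ B p else ~~ B p.+1).
Let U2 p := (b <= p) && (~~ A p.+1 || (B p.+1 && ~~ (A p && B p))).
Let u := wperm n (sweeps n U1 U2).

Let sweepable_v : sweepable n V1 V2.
Proof. by split=> t; rewrite /V1 /V2; lia. Qed.

Let ev_v p : p <= n -> ev (sweeps n V1 V2) p =
  if p == b then n else if p == a then 0 else
  if p < b then p.+1 else if p < a then p else p.-1.
Proof.
move=> pn; rewrite ev_cat.
have [->|pb] := eqVneq p b.
  rewrite ev_asc_run; [|lia|by rewrite /V2; lia|by rewrite /V2; lia].
  by rewrite ev_fix_desc // ?/V1; lia.
case: (ltnP p b) => pb'.
  rewrite ev_fix_asc; [|by rewrite /V2; lia|by rewrite /V2; lia].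
  rewrite ev_desc_step; [|by rewrite /V1; lia|by lia].
  by case: eqP => //; lia.
case: p pn pb pb' => [|p] pn pb pb'; first by lia.
rewrite ev_asc_back; [|lia|by rewrite /V2; lia].
have [E|pa] := eqVneq p.+1 a; first by rewrite ev_desc_run // ?/V1; lia.
case: ltnP => pa' /=; first by rewrite ev_desc_step // ?/V1; lia.
by rewrite ev_fix_desc // ?/V1; lia.
Qed.

Let v_val (p : 'I_n.+1) : v p = ev (sweeps n V1 V2) p :> nat.
Proof. by rewrite wperm_ev // all_sweeps. Qed.

Let v_sorted : middle_sorted v.
Proof.
move=> p q pq; have [pn qn] := (ltn_ord p, ltn_ord q).
rewrite !v_val !ev_v //.
by repeat case: ifPn; lia.
Qed.

Let oa : 'I_n.+1 := inord a.
Let ob : 'I_n.+1 := inord b.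
Let oaE : oa = a :> nat. Proof. by rewrite inordK. Qed.
Let obE : ob = b :> nat. Proof. by rewrite inordK //; lia. Qed.

Let va : v oa = ord0.
Proof. by apply: val_inj; rewrite /= v_val ev_v ?oaE ?eqxx //; case: eqP => //; lia. Qed.

Let vb : v ob = ord_max.
Proof. by apply: val_inj; rewrite /= v_val ev_v ?obE ?eqxx //; lia. Qed.

Let U1n p : B p.+1 -> b <= p -> U1 p = false.
Proof. by rewrite /U1 [p < b]ltnNge => -> -> /=; rewrite andbF. Qed.

(** A letter [t] in both sweeps means that [t.+1] is outside both supports. Being no star, [t.+1]
    has a letter of its own, as [sweepable] requires. *)
Let U_next t : U1 t -> U2 t -> [/\ b <= t, ~~ A t.+1, ~~ B t.+1 & U1 t.+1 || U2 t.+1].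
Proof.
rewrite /U1 /U2 => /andP[ta nB] /andP[bt]; rewrite [t < b]ltnNge bt /= in nB *.
rewrite (negbTE nB) /= orbF => nA; split=> //.
rewrite [_ < b]ltnNge leqW //= (negbTE nA) /= andbT.
have [E|ta'] := eqVneq t.+2 a; first by rewrite E Ba orbT orbT.
have -> : t.+2 < a by lia.
by case: (B t.+2) => //=; rewrite orbT.
Qed.

Let sweepable_u : sweepable n U1 U2.
Proof.
split=> t; first by rewrite /U1; lia.
by move=> U1t U2t; have [_ _ _ /orP[//|->]] := U_next t U1t U2t.
Qed.

Let uv : ble u v.
Proof.
apply: sweeps_le => //; apply: sweeps_sub => p _; first by case/andP.
by case/andP.
Qed.

Let rkv k j := rk_sorted v oa ob k j va vb v_sorted.

Let nextU k : b <= k -> k < a -> ~~ (A k && B k) -> U1 k || U2 k.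
Proof.
move=> bk ka nC; rewrite /U1 /U2 bk nC [_ < b]ltnNge bk /= andbT.
have [->|ka'] := eqVneq k.+1 a; first by rewrite Ba orbT orbT.
have -> : k.+1 < a by lia.
by case: (B k.+1) => //=; rewrite orbT.
Qed.

Let u_below w : subseq w (sweeps n U1 U2) -> ble (wperm n w) u.
Proof. exact: sweeps_le. Qed.

(** * Rank bounds for [u] from short subwords *)

Let sub1_1 k : k < n -> U1 k -> subseq [:: k] (filter U1 (rev (iota 0 n))).
Proof. by move=> kn Uk; rewrite sub1seq mem_filter Uk mem_rev mem_iota. Qed.

Let sub1_2 k : k < n -> U2 k -> subseq [:: k] (filter U2 (iota 0 n)).
Proof. by move=> kn Uk; rewrite sub1seq mem_filter Uk mem_iota. Qed.

Let rk_single k j : k < n -> j <= n -> k < j -> rk (wperm n [:: k]) k.+1 j = minn k j + (k.+1 < j).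
Proof.
by move=> kn jn kj; rewrite rk_wperm_cons // rk_id //; lia.
Qed.

(** The one-letter word [k] is a subword of the reduced word of [u], so its ranks bound those of
    [u]. The next bounds use the two orders of adjacent letters in the same way. *)
Let u_single k : k < n -> U1 k || U2 k -> rk u k.+1 k.+1 <= k.
Proof.
move=> kn Uk; apply: leq_trans (u_below [:: k] _ k.+1 k.+1) _.
  case/orP: Uk => Uk; [rewrite -[[:: k]]cat0s|rewrite -[[:: k]]cats0].
    by apply: cat_subseq; [exact: sub0seq|exact: sub1_1].
  by apply: cat_subseq; [exact: sub1_2|exact: sub0seq].
by rewrite rk_single //; lia.
Qed.

Let pair_iota k : k.+1 < n -> subseq [:: k; k.+1] (iota 0 n).
Proof.
move=> kn; rewrite (iota_split k n) 1?ltnW // -[[:: k; _]]cat0s.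
apply: cat_subseq; first exact: sub0seq.
rewrite -cat1s -[_ :: iota _ _]cat1s; apply: cat_subseq => //.
by rewrite sub1seq mem_iota; lia.
Qed.

Let u_right k : k.+1 < n -> U1 k -> U1 k.+1 || U2 k.+1 -> rk u k.+2 k.+1 <= k.
Proof.
move=> kn Uk Uk'; apply: leq_trans (u_below [:: k.+1; k] _ k.+2 k.+1) _.
  have kn' := ltnW kn; case/orP: Uk' => Uk'; last first.
    by rewrite -cat1s; apply: cat_subseq; [exact: sub1_2|exact: sub1_1].
  rewrite -[[:: _; k]]cat0s; apply: cat_subseq; first exact: sub0seq.
  rewrite subseq_filter /= Uk Uk' /= -[[:: _; k]]/(rev [:: k; k.+1]) subseq_rev.
  exact: pair_iota.
have kn' := ltnW kn; rewrite rk_wperm_cons /= ?kn' //.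
rewrite ev_skip; [|lia|lia].
rewrite rk_wperm_cons //.
rewrite /ev /= rk_id; [|lia|lia].
by rewrite ltnn (_ : (k.+2 < k.+1) = false); lia.
Qed.

Let u_left k : k.+1 < n -> U2 k -> U1 k.+1 || U2 k.+1 -> rk u k.+1 k.+2 <= k.
Proof.
move=> kn Uk Uk'; apply: leq_trans (u_below [:: k; k.+1] _ k.+1 k.+2) _.
  have kn' := ltnW kn; case/orP: Uk' => Uk'.
    by rewrite -cat1s; apply: cat_subseq; [exact: sub1_2|exact: sub1_1].
  rewrite -[[:: k; _]]cats0; apply: cat_subseq; last exact: sub0seq.
  by rewrite subseq_filter /= Uk Uk' /=; exact: pair_iota.
rewrite rk_wperm_cons /= ?kn ?(ltnW kn) //.
rewrite ev_l /ev /= ltnn addn0.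
have ik : @inord n k.+1 = k.+1 :> nat by rewrite inordK //; lia.
have := rk_adj (wperm n [::]) (inord k.+1) k k.+2; rewrite ik ltnS => /(_ kn).
rewrite -[(adj_tr _ * _)%g]/(wperm n [:: k.+1]) => ->.
rewrite (_ : (k == k.+2) = false); last by lia.
by rewrite rk_id //; lia.
Qed.

Let hits_min x (k : 'I_n.+1) : ble u x -> ble x v -> x k = ord0 -> B k.
Proof.
move=> ux xv xk; apply/negPn/negP => nB.
have ka : k < a.
  have := min_pos_le x v oa k va xv xk; rewrite oaE leq_eqVlt => /orP[/eqP E|//].
  by move: nB; rewrite E Ba.
have H j := min_pos_rk u v x k j ux xv xk.
(* The letters attached to [k] contradict [min_pos_rk], at [j = k.+1] up to [b] and at [j = k]
   beyond [b]. *)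
case: (leqP k b) => kb.
  have kn : k < n by lia.
  have Uk : U1 k || U2 k.
    have [E|kb'] := eqVneq (k : nat) b.
      by apply: nextU; rewrite ?(negbTE nB) ?andbF //; lia.
    have {}kb' : k < b by lia.
    rewrite /U1 kb' nB /=; lia.
  move: (u_single k kn Uk) (H k.+1 isT); rewrite rkv ?ltnS //; last exact: ltnW.
  by rewrite /mrk oaE obE; blia.
move: (ltn_ord k) nB ka kb (H k); case E : (k : nat) => [|l] // ln nB ka kb Hl.
have Ul : U1 l by rewrite /U1 ka [_ < b]ltnNge -ltnS kb /= nB.
have Ul' : U1 l.+1 || U2 l.+1.
  by apply: nextU => //; [exact: ltnW|rewrite (negbTE nB) andbF].
have l1n : l.+1 < n by lia.
move: (u_right l l1n Ul Ul') (Hl isT); rewrite rkv //; last exact: ltnW.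
by rewrite /mrk oaE obE; blia.
Qed.

Let hits_max x (k : 'I_n.+1) : ble u x -> ble x v -> x k = ord_max -> A k.
Proof.
move=> ux xv xk; apply/negPn/negP => nA.
have kb : b < k.
  have := max_pos_ge x v ob k vb xv xk; rewrite obE leq_eqVlt => /orP[/eqP E|//].
  by move: nA; rewrite -E Ab.
have H j := max_pos_rk u v x k j ux xv xk.
move: (ltn_ord k) nA kb (H k) (H k.+1); case E : (k : nat) => [|l] // ln nA kb Hl Hl'.
have Ul : U2 l by rewrite /U2 nA /= andbT -ltnS.
(* The contradiction with [max_pos_rk] is at [j = k] from [a] on, and at [j = k.+1] below [a]. *)
case: (leqP a l.+1) => ka.
  have l1n : l < n by lia.
  have := u_single l l1n; rewrite Ul orbT => /(_ isT).
  by move: (Hl l1n); rewrite rkv //= /mrk oaE obE; blia.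
have Ul' : U1 l.+1 || U2 l.+1 by apply: nextU => //; [exact: ltnW|rewrite (negbTE nA)].
have l1n : l.+1 < n by lia.
move: (u_left l l1n Ul Ul') (Hl' l1n); rewrite rkv //=.
by rewrite /mrk oaE obE; blia.
Qed.

(** The witness is a word between those of [u] and [v]: to the letters of [u], rearranged as [T1]
    and [T2], are added those that carry [i] to [n] and [j] to 0. *)
Let pair_hit (i j : 'I_n.+1) : A i -> B j -> i != j ->
  exists x, [/\ ble u x, ble x v, x i = ord_max & x j = ord0].
Proof.
move=> Ai Bj ij.
have {}ij : (i : nat) != j by rewrite -val_eqE in ij.
have [bi ni] := andP (Age i Ai); have ja := Ble j Bj.
(* When i starts a run of stars, its letter i - 1 is moved to the first sweep. *)
pose e := [&& b < i, B i & ~~ (A i.-1 && B i.-1)].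
pose T1 p := U1 p || (e && (p.+1 == i)).
pose T2 p := U2 p && ~~ (e && (p.+1 == i)).
have eS : e -> A i.+1 && B i.+1.
  case/and3P=> bi' Bi nC; case: (noniso i Ai Bi) => // -[q iq C].
  by move: nC; rewrite iq /= C.
have uT : wperm n (sweeps n T1 T2) = u.
  have ext X1 X2 Y1 Y2 : X1 =1 Y1 -> X2 =1 Y2 -> sweeps n X1 X2 = sweeps n Y1 Y2.
    by move=> E1 E2; rewrite /sweeps (eq_filter E1) (eq_filter E2).
  case E: e; last first.
    congr (wperm n _); apply: ext => p; first by rewrite /T1 E orbF.
    by rewrite /T2 E andbT.
  have := eS E; case/and3P: (E) => bi' Bi nC /andP[Ai' Bi'].
  have [l il] : exists l, (i : nat) = l.+1 by exists i.-1; rewrite (ltn_predK bi').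
  rewrite il /= in Ai ni bi bi' Bi nC Ai' Bi'.
  rewrite /u -(sweeps_transfer n U1 U2 l) //.
  - by congr (wperm n _); apply: ext => p; rewrite /T1 /T2 E il.
  - by rewrite /U2 -ltnS bi' Ai Bi nC.
  - by rewrite U1n.
  - by rewrite U1n.
  by rewrite /U2 Ai' Bi' Ai Bi /= andbF.
have T2i t : t.+1 = i -> ~~ T2 t.
  move=> ti; have bt : (b < i) = (b <= t) by rewrite -ti ltnS.
  have it : i.-1 = t by rewrite -ti.
  rewrite /T2 /U2 /e bt it ti eqxx Ai /= andbT.
  by case: (b <= t) => //=; case: (B i) => //=; rewrite andbN.
have T1a t : T1 t -> t.+1 < a.
  rewrite /T1 => /orP[/andP[]//|/andP[E /eqP ->]].
  by have /andP[_ /Ble] := eS E.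
have T2b t : T2 t -> b <= t by case/andP=> /andP[].
have Tnext t : T1 t -> T2 t -> T1 t.+1 || T2 t.+1.
  rewrite /T1 /T2 => + /andP[U2t /negbTE nE]; rewrite nE orbF => U1t.
  have [_ _ _] := U_next t U1t U2t.
  by case: (U1 t.+1) => //= ->; case: (e && _).
suff [X1 [X2 [[X1a X2b] TX1 TX2 X12 [evi evj]]]] : exists X1 X2 : pred nat,
    [/\ (forall t, X1 t -> t.+1 < a) /\ (forall t, X2 t -> b <= t),
        forall t, T1 t -> X1 t, forall t, T2 t -> X2 t,
        forall t, X1 t -> X2 t -> ~~ X2 t.+1 -> X1 t.+1 &
        ev (sweeps n X1 X2) i = n /\ ev (sweeps n X1 X2) j = 0].
  exists (wperm n (sweeps n X1 X2)); split.
  - rewrite -uT; apply: sweeps_le; last by apply: sweeps_sub => p _; [exact: TX1|exact: TX2].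
    by split=> // t /X1a ta; exact: leq_trans ta an.
  - by apply: sweeps_le => //; apply: sweeps_sub => p _; [exact: X1a|exact: X2b].
  - by apply: val_inj; rewrite /= wperm_ev ?all_sweeps.
  by apply: val_inj; rewrite /= wperm_ev ?all_sweeps.
(* The letters of [X2] from [i] on carry [i] to [n], which those of [X1] are too small to touch. *)
have evi (X1 X2 : pred nat) : (forall t, X1 t -> t.+1 < a) -> (forall t, i <= t -> X2 t) ->
    (forall t, t.+1 = i -> ~~ X2 t) -> ev (sweeps n X1 X2) i = n.
  move=> X1a X2i X2i'; rewrite ev_cat ev_asc_run //.
  - apply: ev_fix_desc => [|q E]; apply/negP => /X1a.
      by rewrite ltnNge (leq_trans an (leqnSn n)).
    by rewrite E ltnNge an.
  - by move=> t /andP[it _]; exact: X2i.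
  by move=> t _; exact: X2i'.
have [bj|jb] := ltnP b j.
  have T1j t : t.+1 = j -> ~~ T1 t.
    move=> tj; rewrite /T1 U1n ?tj //; last by rewrite -ltnS tj.
    by rewrite eq_sym (negbTE ij) andbF.
  (* For [j > b] the letter [j - 1] of the [X2] sweep moves [j] down by one, and the [X1] letters
     below then carry it to 0. *)
  exists (fun p => (p.+1 < j) || T1 p), (fun p => [|| i <= p, T2 p | p.+1 == j]).
  split=> [|t -> //|t -> //|t|]; rewrite ?orbT //.
  - split=> t.
      by case/orP=> [tj|/T1a //]; exact: leq_trans tj ja.
    case/or3P=> [it|/T2b //|/eqP tj]; first exact: leq_trans bi it.
    by rewrite -ltnS tj.
  - case: (ltnP t.+1 j) => [tj _ _|tj /= T1t].
      rewrite !negb_or => /and3P[_ _ tj']; apply/orP; left.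
      by rewrite ltn_neqAle tj' tj.
    have [E|tj'] := eqVneq t.+1 j; first by have := T1j t E; rewrite T1t.
    rewrite orbF => /orP[it|T2t].
      by rewrite (leq_trans it (leqnSn t)).
    have := Tnext t T1t T2t; case: (T1 t.+1); first by rewrite orbT.
    by move=> /= ->; rewrite orbT.
  split; first apply: evi => [t|t ->//|t ti].
  - by case/orP=> [tj|/T1a //]; exact: leq_trans tj ja.
  - by rewrite (negbTE (T2i t ti)) ti (negbTE ij) !orbF -ti ltnn.
  rewrite ev_cat; case: (j : nat) bj ja T1j (ltn_ord j) => [|q] // bq qa T1q qn.
  rewrite ev_asc_back ?eqxx ?orbT //; apply: ev_desc_run => [|_|t tq]; first exact: ltnW.
    by rewrite ltnn /=; exact: T1q.
  by rewrite ltnS tq.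
(* Only [j = b] is in question. Then [b] is a star, and since [b - 1] is outside [A], its star
   neighbour is [b + 1]; this removes the letter [b] from both sweeps. *)
have T2j : ~~ T2 j.
  apply/negP => /andP[/andP[bj]]; have E : (j : nat) = b by apply/eqP; rewrite eqn_leq jb.
  have [/andP[-> ->]|[q jq /andP[/Age/andP[bq _] _]]] := noniso j (eq_ind_r A Ab E) Bj; last first.
    by move: jb; rewrite jq ltnNge bq.
  by rewrite Bj E Ab.
have T1j : ~~ T1 j.
  apply/negP; rewrite /T1 /U1 Bj => /orP[/andP[ja']|/andP[/and3P[bi' _ nC] /eqP ji]].
    case: ltnP => // bj; have E : (j : nat) = b by apply/eqP; rewrite eqn_leq jb.
    have [/andP[_ ->]//|[q jq /andP[/Age/andP[bq _] _]]] := noniso j (eq_ind_r A Ab E) Bj.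
    by move: jb; rewrite jq ltnNge bq.
  have E : (j : nat) = b by apply/eqP; rewrite eqn_leq jb -ltnS ji.
  by move: nC; rewrite -ji /= Bj E Ab.
(* For [j <= b] the [X2] sweep leaves [j] in place, and the [X1] letters below [j] carry it to 0. *)
exists (fun p => (p < j) || T1 p), (fun p => (i <= p) || T2 p).
split=> [|t -> //|t -> //|t|]; rewrite ?orbT //.
- split=> t.
    by case/orP=> [tj|/T1a //]; apply: leq_ltn_trans ba; exact: leq_trans tj jb.
  by case/orP=> [it|/T2b //]; exact: leq_trans bi it.
- move=> X1t X2t; have bt : b <= t.
    by case/orP: X2t => [it|/T2b //]; exact: leq_trans bi it.
  have T1t : T1 t by case/orP: X1t => //; rewrite ltnNge (leq_trans jb bt).
  case/orP: X2t => [it|T2t]; first by rewrite (leq_trans it (leqnSn t)).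
  have := Tnext t T1t T2t; case: (T1 t.+1); first by rewrite orbT.
  by move=> /= ->; rewrite orbT.
split; first apply: evi => [t|t ->//|t ti].
- by case/orP=> [tj|/T1a //]; apply: leq_ltn_trans ba; exact: leq_trans tj jb.
- by rewrite (negbTE (T2i t ti)) orbF -ti ltnn.
rewrite ev_cat ev_fix_asc.
- apply: ev_desc_run => [|_|t ->//]; first by rewrite -ltnS.
  by rewrite ltnn.
- by rewrite (negbTE T2j) orbF -ltnNge ltn_neqAle eq_sym ij (leq_trans jb bi).
move=> q qj; apply/negP => /orP[iq|/T2b bq].
  by move: (leq_trans jb (leq_trans bi iq)); rewrite -qj ltnn.
by move: (leq_trans jb bq); rewrite -qj ltnn.
Qed.

Lemma interval_of_supports : exists u v : {perm 'I_n.+1},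
  [/\ middle_sorted v, ble u v,
      forall x k, ble u x -> ble x v -> x k = ord_max -> A k,
      forall x k, ble u x -> ble x v -> x k = ord0 -> B k &
      forall i j : 'I_n.+1, A i -> B j -> i != j ->
        exists x, [/\ ble u x, ble x v, x i = ord_max & x j = ord0]].
Proof. by exists u, v; split. Qed.

End Sufficiency.

(** * Polytopes *)

Local Open Scope ring_scope.

Lemma in_conv_point (R : realType) n (I : finType) (P : I -> Prop)
    (f : I -> 'rV[R]_n) i : P i -> in_conv P f (f i).
Proof.
move=> Pi; exists (fun k => (k == i)%:R); split=> [k|k nPk||].
- exact: ler0n.
- by case: eqP nPk => // ->.
- by rewrite (bigD1 i) //= eqxx big1 ?addr0 // => k /negbTE ->.
by rewrite (bigD1 i) //= eqxx scale1r big1 ?addr0 // => k /negbTE ->; rewrite scale0r.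
Qed.

Lemma in_conv_trans (R : realType) n (I J : finType) (P : I -> Prop) (Q : J -> Prop)
    (f : I -> 'rV[R]_n) (g : J -> 'rV[R]_n) x :
  in_conv P f x -> (forall i, P i -> in_conv Q g (f i)) -> in_conv Q g x.
Proof.
case=> lam [lam0 lamP lam1 ->] PQ.
(* Weights [mu i] are required only where [lam i] is nonzero, since only there is [P i] known. *)
have /fin_all_exists [mu muP] i : exists mu : J -> R, lam i != 0 ->
    [/\ forall j, 0 <= mu j, forall j, ~ Q j -> mu j = 0,
        \sum_j mu j = 1 & f i = \sum_j mu j *: g j].
  have [_|li] := eqVneq (lam i) 0; first by exists (fun=> 0).
  have Pi : P i by apply: contrapT => /lamP E; rewrite E eqxx in li.
  by have [mu H] := PQ i Pi; exists mu.
exists (fun j => \sum_i lam i * mu i j); split=> [j|j nQ||].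
- apply: sumr_ge0 => i _; have [->|li] := eqVneq (lam i) 0; first by rewrite mul0r.
  by have [mu0 _ _ _] := muP i li; rewrite mulr_ge0.
- apply: big1 => i _; have [->|li] := eqVneq (lam i) 0; first by rewrite mul0r.
  by have [_ -> //] := muP i li; rewrite mulr0.
- rewrite exchange_big -[RHS]lam1; apply: eq_bigr => i _ /=; rewrite -mulr_sumr.
  have [->|li] := eqVneq (lam i) 0; first by rewrite mul0r.
  by have [_ _ -> _] := muP i li; rewrite mulr1.
under [RHS]eq_bigr do rewrite scaler_suml.
rewrite exchange_big; apply: eq_bigr => i _ /=.
have [->|li] := eqVneq (lam i) 0.
  by rewrite scale0r big1 // => j _; rewrite mul0r scale0r.
have [_ _ _ ->] := muP i li; rewrite scaler_sumr.
by apply: eq_bigr => j _; rewrite scalerA.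
Qed.

Lemma in_conv_add (R : realType) n (I J : finType) (P : I -> Prop) (Q : J -> Prop)
    (f : I -> 'rV[R]_n) (g : J -> 'rV[R]_n) x y :
  in_conv P f x -> in_conv Q g y ->
  in_conv (fun p : I * J => P p.1 /\ Q p.2) (fun p => f p.1 + g p.2) (x + y).
Proof.
case=> lam [lam0 lamP lam1 ->] [mu [mu0 muQ mu1 ->]].
have pairE (F : I -> J -> R) : \sum_(p : I * J) F p.1 p.2 = \sum_i \sum_j F i j.
  by rewrite pair_big.
have pairV (F : I -> J -> 'rV[R]_n) : \sum_(p : I * J) F p.1 p.2 = \sum_i \sum_j F i j.
  by rewrite pair_big.
exists (fun p => lam p.1 * mu p.2); split=> [p|p nPQ||].
- exact: mulr_ge0.
- have [->|l0] := eqVneq (lam p.1) 0; first by rewrite mul0r.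
  rewrite muQ ?mulr0 // => Qp; apply: nPQ; split=> //.
  by apply: contrapT => /lamP E; rewrite E eqxx in l0.
- rewrite (pairE (fun i j => lam i * mu j)) -[RHS]lam1.
  by apply: eq_bigr => i _; rewrite -mulr_sumr mu1 mulr1.
rewrite (pairV (fun i j => (lam i * mu j) *: (f i + g j))).
under [RHS]eq_bigr => i _.
  under eq_bigr => j _ do rewrite scalerDr -[in X in _ + X]scalerA.
  rewrite big_split /= -scaler_suml -mulr_sumr mu1 mulr1 -scaler_sumr.
  over.
by rewrite big_split /= -scaler_suml lam1 scale1r.
Qed.

(* A linear functional attains its maximum over a polytope at one of the
   spanning points; the functional used is a difference of two coordinates. *)
Lemma in_conv_attain (R : realType) n (I : finType) (P : I -> Prop)
    (f : I -> 'rV[R]_n) x (i j : 'I_n) (c : R) : in_conv P f x ->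
  (forall k, P k -> f k ord0 i - f k ord0 j <= c) -> x ord0 i - x ord0 j = c ->
  exists2 k, P k & f k ord0 i - f k ord0 j = c.
Proof.
case=> lam [lam0 lamP lam1 ->] Pc E; apply: contrapT => H.
have term0 k : true -> 0 <= lam k * (c - (f k ord0 i - f k ord0 j)).
  move=> _; have [->|l0] := eqVneq (lam k) 0; first by rewrite mul0r.
  rewrite mulr_ge0 // subr_ge0; apply: Pc.
  by apply: contrapT => /lamP l0'; rewrite l0' eqxx in l0.
have sum0 : \sum_k lam k * (c - (f k ord0 i - f k ord0 j)) = 0.
  transitivity ((\sum_k lam k) * c -
      ((\sum_k lam k *: f k) ord0 i - (\sum_k lam k *: f k) ord0 j)).
    rewrite !summxE mulr_suml -!sumrB; apply: eq_bigr => k _.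
    by rewrite !mxE !mulrBr.
  by rewrite E lam1 mul1r subrr.
have lamz k : lam k = 0.
  have := psumr_eq0P term0 sum0 (isT : true) => /(_ k)/eqP; rewrite mulf_eq0 => /orP[/eqP//|].
  rewrite subr_eq0 eq_sym => /eqP Ek; apply: lamP => Pk; apply: H; by exists k.
by move: lam1; rewrite big1 // => /esym/eqP; rewrite oner_eq0.
Qed.

(** Translated by [-(1,...,1)] this is [e_i - e_j]: a root for [i != j], the origin for [i = j]. *)
Definition vtx (R : realType) {n} (i j : 'I_n) : 'rV[R]_n :=
  unit_vec R i + ind_vec R (~: [set j]).

Lemma piv_vtx (R : realType) n (x : {perm 'I_n.+1}) : (0 < n)%N ->
  piv R x = vtx R (x^-1%g ord_max) (x^-1%g ord0).
Proof.
move=> n0; apply/rowP => k; rewrite -[X in piv R x X]/ord0 piv_coord !mxE !inE.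
have om : (ord0 == ord_max :> 'I_n.+1) = false by rewrite -val_eqE /=; lia.
have Ek y : (k == x^-1%g y) = (x k == y).
  by rewrite -[RHS](inj_eq (@perm_inj _ x^-1%g)) permK.
rewrite !Ek; have [->|x0] := eqVneq (x k) ord0; first by rewrite om addr0.
by case: eqVneq => _; rewrite ?add0r // -natrD.
Qed.

(** Each of the two summands contributes at most 1 to the difference, so 2 is reached only if both
    contribute 1. *)
Lemma unit_ind_diff (R : realType) n (i j i' : 'I_n) (S : {set 'I_n}) :
  let y := unit_vec R i' + ind_vec R S in
  y ord0 i - y ord0 j <= 2%:R /\
  (y ord0 i - y ord0 j = 2%:R -> i = i' /\ j \notin S).
Proof.
rewrite /= !mxE.
have H (p q r t : bool) : p%:R + q%:R - (r%:R + t%:R) <= 2%:R :> R /\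
    (p%:R + q%:R - (r%:R + t%:R) = 2%:R :> R -> p && ~~ t).
  by case: p; case: q; case: r; case: t => /=;
    (split; [lra|by [] || (move=> E; exfalso; lra)]).
have [le2 eq2] := H (i == i') (i \in S) (j == i') (j \in S).
by split=> // /eq2 /andP[/eqP].
Qed.

Lemma vtx_diff (R : realType) n (i j : 'I_n) : i != j ->
  vtx R i j ord0 i - vtx R i j ord0 j = 2%:R.
Proof.
move=> ij; rewrite !mxE !inE !eqxx ij eq_sym (negbTE ij) /=.
by rewrite !addr0 subr0 -natrD.
Qed.

Lemma corank1_basis n (S : {set 'I_n}) (j : 'I_n) :
  #|S| = n.-1 -> j \notin S -> S = ~: [set j].
Proof.
move=> cS jS; apply/eqP; rewrite eqEcard cardsC1 card_ord cS leqnn andbT.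
by apply/subsetP => k kS; rewrite !inE; apply: contraNneq jS => <-.
Qed.

Lemma flag_vertex (R : realType) n (BM BN : {set {set 'I_n}}) (i j : 'I_n) :
  has_rank BN n.-1 -> i != j -> flag_polytope BM BN (vtx R i j) ->
  [set i] \in BM /\ ~: [set j] \in BN.
Proof.
move=> rN ij [x [y [cx cy E]]]; have := in_conv_add _ _ _ _ _ _ _ _ _ _ cx cy.
rewrite -E => /in_conv_attain /(_ _ (vtx_diff _ _ _ _ ij)).
case=> [[i' S] _|[i' S] [/= BMi BNS]]; first by have [] := unit_ind_diff R n i j i' S.
have [_ H] := unit_ind_diff R n i j i' S; move=> /H [-> jS]; split=> //.
by rewrite -(corank1_basis n S j (rN _ BNS) jS).
Qed.

Lemma bruhat_vertex (R : realType) n (u v : {perm 'I_n.+1}) (i j : 'I_n.+1) :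
  (0 < n)%N -> i != j -> bruhat_polytope u v (vtx R i j) ->
  exists x, [/\ bruhat_le u x, bruhat_le x v, x i = ord_max & x j = ord0].
Proof.
move=> n0 ij /in_conv_attain /(_ _ (vtx_diff _ _ _ _ ij)).
case=> [x _|x [ux xv]]; rewrite piv_vtx //.
  by have [] := unit_ind_diff R _ i j (x^-1%g ord_max) (~: [set x^-1%g ord0]).
have [_ H] := unit_ind_diff R _ i j (x^-1%g ord_max) (~: [set x^-1%g ord0]).
move=> /H [-> jS]; exists x; split=> //; rewrite ?permKV //.
by move: jS; rewrite !inE negbK => /eqP ->; rewrite permKV.
Qed.

(** * Stars of the flag matroid *)

(** Take [i] with positive weight [lam i] in the point from [M]. If [~: [set i]] were no basis of
    [N], every basis of [N] would contain [i], and coordinate [i] of the sum would be [1 + lam i]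
    and not 1. *)
Lemma star_exists (R : realType) n (BM BN : {set {set 'I_n}}) :
  has_rank BN n.-1 -> flag_polytope BM BN (const_mx 1 : 'rV[R]_n) ->
  exists i, [set i] \in BM /\ ~: [set i] \in BN.
Proof.
move=> rN [x [y [[lam [lam0 lamP lam1 Ex]] [mu [mu0 muP mu1 Ey]] E]]].
have [i li] : exists i, lam i != 0.
  apply: contrapT => H; move: lam1; rewrite big1 => [/esym/eqP|i _].
    by rewrite oner_eq0.
  by apply/eqP/negPn/negP => li; apply: H; exists i.
have xi : x ord0 i = lam i.
  rewrite Ex summxE (bigD1 i) //= !mxE eqxx mulr1 big1 ?addr0 // => k ki.
  by rewrite !mxE eq_sym (negbTE ki) mulr0.
have BMi : [set i] \in BM by apply: contraT => /negP/lamP l0; rewrite l0 eqxx in li.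
exists i; split=> //; apply: contraT => nB.
have yi : y ord0 i = 1.
  rewrite Ey summxE -[RHS]mu1; apply: eq_bigr => S _; rewrite !mxE.
  case: (boolP (i \in S)) => iS; first by rewrite mulr1.
  have -> : mu S = 0; last by rewrite mul0r.
  by apply: muP => BS; move: nB; rewrite -(corank1_basis n S i (rN _ BS) iS) BS.
have := congr1 (fun z : 'rV[R]_n => z ord0 i) E; rewrite !mxE xi yi => E1.
have l0 : lam i = 0 by clear -E1; lra.
by rewrite l0 eqxx in li.
Qed.

(** The loops of [M] form a flat [F] of [M], hence of [N], not containing [i]. Without a second
    star, the element missed by any basis of [N] would lie in [i |: F], so adding [i] would not
    raise the rank of [F] in [N], which is [#|F|] because the basis [~: [set i]] contains [F]. *)
Lemma second_star n (BM BN : {set {set 'I_n}}) (i : 'I_n) :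
  flag_matroid_1_nm1 BM BN -> [set i] \in BM -> ~: [set i] \in BN ->
  exists j, [/\ i != j, [set j] \in BM & ~: [set j] \in BN].
Proof.
case=> _ _ rM rN flats BMi BNi; apply: contrapT => none.
pose F : {set 'I_n} := [set k | [set k] \notin BM].
have flatF : is_flat BM F.
  move=> x; rewrite inE negbK => BMx; apply: (@leq_ltn_trans 0).
    apply/bigmax_leqP => S BS; rewrite leqn0 cards_eq0.
    have /eqP/cards1P [k Sk] := rM S BS; apply/eqP/setP => p; rewrite Sk !inE.
    by apply/negbTE; rewrite negb_and negbK; case: eqP => [->|]; rewrite ?orbT // -Sk BS.
  apply: leq_trans (leq_bigmax_cond _ BMx); rewrite card_gt0.
  by apply/set0Pn; exists x; rewrite !inE eqxx.
have iF : i \notin F by rewrite inE BMi.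
have := flats F flatF i iF; rewrite ltnNge => /negP; apply.
apply: (@leq_trans #|F|).
  apply/bigmax_leqP => S BS.
  have /eqP : #|~: S| = 1%N.
    by have := cardsC S; rewrite card_ord (rN S BS); have := ltn_ord i; lia.
  case/cards1P=> j Sj; have jF : j \in i |: F.
    rewrite !inE; case: eqVneq => //= ji; apply/negP => BMj; apply: none.
    by exists j; rewrite eq_sym ji BMj -Sj setCK BS.
  have cF : #|i |: F| = #|F|.+1 by rewrite cardsU1 iF.
  rewrite (cardsD1 j (i |: F)) jF add1n in cF; case: cF => <-.
  apply: subset_leq_card; apply/subsetP => k; rewrite !inE => /andP[-> kS].
  rewrite andbT; apply: contraTneq kS => ->; have := set11 j; rewrite -Sj inE.
  by [].
apply: leq_trans (leq_bigmax_cond _ BNi); apply: subset_leq_card.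
by apply/subsetP => k kF; rewrite !inE in kF *; rewrite kF; apply: contraNneq kF => ->.
Qed.

(** * The two implications *)

Lemma alpha_star n (BM BN : {set {set 'I_n}}) i :
  alpha BM BN i = Sstar <-> [set i] \in BM /\ ~: [set i] \in BN.
Proof. by rewrite /alpha; case: (_ \in BM); case: (_ \in BN); split=> // -[]. Qed.

(** For [i != j] the functional [x_i - x_j] is at most 2 on both families of generators, so
    [vtx R i j] lies in either polytope only if a generator with the right pair attains 2; equal
    polytopes thus have the same pairs. *)
Lemma bruhat_polytope_star (R : realType) n (BM BN : {set {set 'I_n.+1}})
    (u v : {perm 'I_n.+1}) : (0 < n)%N -> has_rank BN n ->
  (forall x, flag_polytope (R := R) BM BN x <-> bruhat_polytope u v x) ->
  forall i j, i != j ->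
    ([set i] \in BM /\ ~: [set j] \in BN <->
     exists x, [/\ ble u x, ble x v, x i = ord_max & x j = ord0]).
Proof.
move=> n0 rN PQ i j ij; split=> [[BMi BNj]|[x [ux xv xi xj]]].
  have [|x [/bruhat_leP ux /bruhat_leP xv xi xj]] := bruhat_vertex R n u v i j n0 ij.
    by apply/PQ; exists (unit_vec R i), (ind_vec R (~: [set j]));
      split=> //; apply: (in_conv_point R _ _ _ (fun S => ind_vec R S)) ||
                  apply: in_conv_point.
  by exists x.
apply: (flag_vertex R) => //; apply/PQ.
have -> : vtx R i j = piv R x.
  by rewrite piv_vtx // -xi -xj !permK.
by apply: in_conv_point; split; apply/bruhat_leP.
Qed.

Lemma flag_to_no_isolated (R : realType) n (BM BN : {set {set 'I_n.+1}}) :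
  (0 < n)%N -> flag_matroid_1_nm1 BM BN ->
  is_bruhat_polytope (flag_polytope (R := R) BM BN) -> ~ has_isolated_star BM BN.
Proof.
move=> n0 flag [u [v [/bruhat_leP uv vmin PQ]]] [c [/alpha_star [cM cN] iso]].
have [_ _ _ rN _] := flag; have [c' [cc' cM' cN']] := second_star _ _ _ _ flag cM cN.
have star := bruhat_polytope_star R n BM BN u v n0 rN PQ.
pose hits k y := exists x, [/\ ble u x, ble x v & x k = y].
have hitM i j : i != j -> [set i] \in BM -> ~: [set j] \in BN ->
    hits i ord_max /\ hits j ord0.
  move=> ij iM jN; have [x [ux xv xi xj]] := proj1 (star i j ij) (conj iM jN).
  by split; exists x.
have [h1 h2] := hitM c c' cc' cM cN'.
have [h3 h4] : hits c' ord_max /\ hits c ord0 by apply: hitM => //; rewrite eq_sym.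
have om : ord_max != ord0 :> 'I_n.+1 by rewrite -val_eqE /=; lia.
have [k [kc [x [ux xv xk]] [y [uy yv yk]]]] :=
  no_isolated u v hits n0 (minimal_sorted R v vmin) uv (fun _ _ => iff_refl _)
    c c' cc' h4 h1 h2 h3.
(* The permutation [y] has its maximum at [k] and [x] has its 0 there. In each the other extreme
   value sits elsewhere, so [star] applies to a pair of distinct positions. *)
apply: (iso k kc); apply/alpha_star; split.
  have kx : k != (y^-1)%g ord0.
    by apply: contra_neq om => E; rewrite -yk E permKV.
  apply: (proj1 (proj2 (star _ _ kx) _)); exists y; split=> //; exact: permKV.
have kx : (x^-1)%g ord_max != k.
  by apply: contra_neq om => E; rewrite -xk -E permKV.
apply: (proj2 (proj2 (star _ _ kx) _)); exists x; split=> //; exact: permKV.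
Qed.

Lemma no_isolated_to_bruhat (R : realType) n (BM BN : {set {set 'I_n.+1}}) :
  (0 < n)%N -> flag_matroid_1_nm1 BM BN ->
  flag_polytope BM BN (const_mx 1 : 'rV[R]_n.+1) ->
  ~ has_isolated_star BM BN -> is_bruhat_polytope (flag_polytope (R := R) BM BN).
Proof.
move=> n0 flag P1 niso; have [_ _ rM rN _] := flag.
have [i [iM iN]] := star_exists R _ _ _ rN P1.
have [j [ij jM jN]] := second_star _ _ _ _ flag iM iN.
pose A p := (p < n.+1)%N && ([set inord p] \in BM).
pose B p := (p < n.+1)%N && (~: [set inord p] \in BN).
have AE (k : 'I_n.+1) : A k = ([set k] \in BM) by rewrite /A ltn_ord inord_val.
have BE (k : 'I_n.+1) : B k = (~: [set k] \in BN) by rewrite /B ltn_ord inord_val.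
have exA : exists p, A p by exists i; rewrite AE.
have exB : exists p, B p by exists i; rewrite BE.
have Bn p : B p -> (p <= n)%N by case/andP.
have [b Ab bmin] := ex_minnP exA; have [a Ba amax] := ex_maxnP exB Bn.
have an := Bn a Ba.
(* Both stars [i] and [j] lie in [A] and in [B], so the least element of [A] is below the largest of
   [B]. *)
have ba : (b < a)%N.
  move: ij; rewrite -val_eqE /= => ij.
  have [Ai Aj] : A i /\ A j by rewrite !AE.
  have [Bi Bj] : B i /\ B j by rewrite !BE.
  move: (bmin _ Ai) (bmin _ Aj) (amax _ Bi) (amax _ Bj) ij; lia.
have [||p Ap Bp|u [v [vs uv uvA uvB hit]]] :=
    interval_of_supports n A B a b Ab Ba an ba.
- by move=> p Ap; rewrite bmin //; case/andP: Ap.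
- exact: amax.
- apply: contrapT => H; apply: niso; have [pn pM] := andP Ap; have [_ pN] := andP Bp.
  exists (inord p); split; first exact/alpha_star.
  move=> k; rewrite /= inordK // => -[kp|kp] /alpha_star []; rewrite -AE -BE => Ak Bk.
    by apply: H; right; exists (k : nat); rewrite ?Ak.
  by apply: H; left; rewrite -kp Ak.
exists u, v; split; first exact/bruhat_leP; first exact: sorted_minimal.
have vtxQ k l : k != l -> [set k] \in BM -> ~: [set l] \in BN ->
    bruhat_polytope u v (vtx R k l).
  rewrite -AE -BE => kl Ak Bl; have [x [ux xv xk xl]] := hit k l Ak Bl kl.
  have -> : vtx R k l = piv R x by rewrite piv_vtx // -xk -xl !permK.
  by apply: in_conv_point; split; apply/bruhat_leP.
move=> x; split=> [[y [z [cy cz ->]]]|cx].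
  apply: in_conv_trans (in_conv_add _ _ _ _ _ _ _ _ _ _ cy cz) _ => -[k S] [/= kM SN].
  have /eqP : #|~: S| = 1%N.
    by have := cardsC S; rewrite card_ord (rN S SN) /=; lia.
  case/cards1P=> l Sl; have SE : S = ~: [set l] by rewrite -Sl setCK.
  rewrite SE in SN *; have [kl|kl] := eqVneq k l; last exact: vtxQ.
  (* The point with [k = l] is [(1,...,1)], the midpoint of the two vertices given by the stars [i]
     and [j]. *)
  have -> : unit_vec R k + ind_vec R (~: [set l]) =
      \sum_(e : bool) 2%:R^-1 *: (if e then vtx R i j else vtx R j i).
    rewrite big_bool kl; apply/rowP => p; rewrite !mxE !inE.
    have [->|pi] := eqVneq p i; first by rewrite (negbTE ij); case: (i == l) => /=; lra.
    by case: (p == j); case: (p == l) => /=; lra.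
  apply: (@in_conv_trans R _ _ _ (fun=> True) _ (fun e : bool => if e then vtx R i j else vtx R j i)).
    exists (fun=> 2%:R^-1); split=> [_|//||//]; first by rewrite invr_ge0 ler0n.
    by rewrite big_bool /=; lra.
  by case=> _; apply: vtxQ; rewrite // eq_sym.
have {cx} [lam [lam0 lamP lam1 ->]] := cx.
(* By [piv_vtx] every [piv R y] splits into a point from [M] and one from [N], so the same weights
   serve both summands. *)
exists (\sum_y lam y *: unit_vec R (y^-1%g ord_max)).
exists (\sum_y lam y *: ind_vec R (~: [set y^-1%g ord0])).
pose Q y := bruhat_le u y /\ bruhat_le y v; split.
- apply: (@in_conv_trans R _ _ _ Q _ (fun y => unit_vec R (y^-1%g ord_max))).
    by exists lam; split.
  move=> y [/bruhat_leP uy /bruhat_leP yv]; apply: in_conv_point; rewrite -AE.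
  by apply: uvA uy yv _; rewrite permKV.
- apply: (@in_conv_trans R _ _ _ Q _ (fun y => ind_vec R (~: [set y^-1%g ord0]))).
    by exists lam; split.
  move=> y [/bruhat_leP uy /bruhat_leP yv].
  apply: (in_conv_point R _ _ _ (fun S => ind_vec R S)); rewrite -BE.
  by apply: uvB uy yv _; rewrite permKV.
rewrite -big_split /=; apply: eq_bigr => y _; rewrite -scalerDr; congr (_ *: _).
by rewrite piv_vtx.
Qed.

Theorem theorem6p4 (R : realType) (n : nat) (BM BN : {set {set 'I_n}}) :
  flag_matroid_1_nm1 BM BN ->
  flag_polytope BM BN (const_mx 1 : 'rV[R]_n) ->
  (is_bruhat_polytope (flag_polytope (R := R) BM BN) <->
   ~ has_isolated_star BM BN).
Proof.
move=> flag P1; have [_ _ _ rN _] := flag.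
have [i [iM iN]] := star_exists R _ _ _ rN P1.
have [j [ij _ _]] := second_star _ _ _ _ flag iM iN.
(* The two distinct stars exclude ground sets with fewer than two elements, where 1 and [n] would
   not be distinct values. *)
case: n BM BN flag P1 {rN} i iM iN j ij => [|n] BM BN flag P1; first by case.
move=> i _ _ j ij; have n0 : (0 < n)%N.
  by move: ij; rewrite -val_eqE /=; have := ltn_ord i; have := ltn_ord j; lia.
by split; [exact: flag_to_no_isolated|exact: no_isolated_to_bruhat].
Qed.
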